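(* Let $n\ge 2$ and let $\Omega\subset\mathbb{R}^n$ be a bounded $(\alpha,\beta)$-John domain. If $\delta\in(0,n]$ and $p\in(\delta/n,\infty)$, then there exists a constant $c(n,p,\delta)$, depending only on $n$, $p$ and $\delta$, such that $$\inf_{b\in\mathbb{R}}\int_\Omega|u(x)-b|^p\,d\mathcal{H}^\delta_\infty\le c(n,p,\delta)\,\beta^p\Big(\frac{\beta}{\alpha}\Big)^{2np}\int_\Omega|\nabla u(x)|^p\,d\mathcal{H}^\delta_\infty$$ for all $u\in C^1(\Omega)$.
   Context: A domain is an open, connected set in $\mathbb{R}^n$, $n\ge 2$. For $\delta\in(0,n]$ and $E\subset\mathbb{R}^n$, the $\delta$-dimensional Hausdorff content is $$\mathcal{H}^\delta_\infty(E):=\inf\Big\{\sum_{i} r_i^\delta : E\subset\bigcup_{i}B(x_i,r_i)\Big\},$$ the infimum being taken over all finite or countable coverings of $E$ by open balls $B(x_i,r_i)$. For $f:\Omega\to[0,\infty]$ the Choquet integral with respect to $\mathcal{H}^\delta_\infty$ is $$\int_\Omega f(x)\,d\mathcal{H}^\delta_\infty:=\int_0^\infty\mathcal{H}^\delta_\infty(\{x\in\Omega: f(x)>t\})\,dt .$$ A bounded domain $\Omega\subset\mathbb{R}^n$ is an $(\alpha,\beta)$-John domain, $0<\alpha\le\beta<\infty$, if there is a point $x_0\in\Omega$ such that each $x\in\Omega$ can be joined to $x_0$ by a rectifiable curve $\gamma_x:[0,\ell(\gamma_x)]\to\Omega$, parametrized by arc length, with $\gamma_x(0)=x$, $\gamma_x(\ell(\gamma_x))=x_0$,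 $\ell(\gamma_x)\le\beta$, and $\operatorname{dist}(\gamma_x(t),\partial\Omega)\ge\frac{\alpha}{\beta}t$ for all $t\in[0,\ell(\gamma_x)]$. $C^1(\Omega)$ denotes the continuously differentiable real-valued functions on $\Omega$. Integrals may take the value $\infty$. *)

(* Defs.v *)
From HB Require Import structures.
From mathcomp Require Export all_boot all_order all_algebra.
From mathcomp Require Export all_classical all_reals all_analysis.

Set Implicit Arguments.
Unset Strict Implicit.
Unset Printing Implicit Defensive.

Export Order.TTheory GRing.Theory Num.Theory.
Export numFieldNormedType.Exports.

Local Open Scope classical_set_scope.
Local Open Scope ring_scope.

(* The library norm on 'rV[R]_n is the maximum norm. It induces the usual
   topology and the usual bounded sets, but metric quantities below use the
   Euclidean norm. *)
Definition norm2 (R : realType) (n : nat) (v : 'rV[R]_n) : R :=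
  Num.sqrt (\sum_(i < n) v ord0 i ^+ 2).

Definition ball2 (R : realType) (n : nat) (x : 'rV[R]_n) (r : R)
    : set 'rV[R]_n :=
  [set y | norm2 (y - x) < r].

(* Finite or countable coverings are indexed by an arbitrary D : set nat. *)
Definition hausdorff_content (R : realType) (n : nat) (delta : R)
    (E : set 'rV[R]_n) : \bar R :=
  ereal_inf [set s | exists (D : set nat) (x : nat -> 'rV[R]_n) (r : nat -> R),
    [/\ forall i, D i -> 0 < r i,
        E `<=` \bigcup_(i in D) ball2 (x i) (r i)
      & s = (\esum_(i in D) ((r i `^ delta)%:E))%E]].

Definition choquet_integral (R : realType) (n : nat) (delta : R)
    (Omega : set 'rV[R]_n) (f : 'rV[R]_n -> \bar R) : \bar R :=
  (\int[@lebesgue_measure R]_(t in `[0%R, +oo[)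
     hausdorff_content delta [set x | Omega x /\ t%:E < f x])%E.

Definition boundary (T : topologicalType) (A : set T) : set T :=
  closure A `\` interior A.

Definition dist2 (R : realType) (n : nat) (x : 'rV[R]_n) (A : set 'rV[R]_n)
    : \bar R :=
  ereal_inf [set (norm2 (x - y))%:E | y in A].

(* Length of g on [a, b]: the supremum of the lengths of inscribed polygons.
   A partition a < s_0 < ... < s_k = b is represented by s, without a. *)
Definition curve_length (R : realType) (n : nat) (a b : R)
    (g : R -> 'rV[R]_n) : \bar R :=
  ereal_sup [set (\sum_(0 <= i < size s)
      norm2 (g (nth b (a :: s) i.+1) - g (nth b (a :: s) i)))%:E
    | s in itv_partition a b].

(* The last condition makes g rectifiable, of total length l. *)
Definition arclength_curve (R : realType) (n : nat) (l : R)
    (g : R -> 'rV[R]_n) : Prop :=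
  [/\ 0 <= l,
      {within `[0, l], continuous g}
    & forall t, 0 <= t <= l -> curve_length 0 t g = t%:E].

Definition domain (R : realType) (n : nat) (Omega : set 'rV[R]_n) : Prop :=
  open Omega /\ connected Omega.

Definition john_domain (R : realType) (n : nat) (alpha beta : R)
    (Omega : set 'rV[R]_n) : Prop :=
  [/\ domain Omega, bounded_set Omega, 0 < alpha <= beta &
    exists2 x0 : 'rV[R]_n, Omega x0 &
      forall x, Omega x -> exists (l : R) (g : R -> 'rV[R]_n),
        [/\ arclength_curve l g,
            (forall t, 0 <= t <= l -> Omega (g t)),
            g 0 = x /\ g l = x0,
            l <= beta
          & forall t, 0 <= t <= l ->
              ((alpha / beta * t)%:E <= dist2 (g t) (boundary Omega))%E]].

Definition gradient (R : realType) (n : nat) (u : 'rV[R]_n -> R)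
    (x : 'rV[R]_n) : 'rV[R]_n :=
  \row_(i < n) 'D_(delta_mx ord0 i) u x.

(* A function on an open set Omega is given by a total function u, whose
   values outside Omega are irrelevant. *)
Definition C1 (R : realType) (n : nat) (Omega : set 'rV[R]_n)
    (u : 'rV[R]_n -> R) : Prop :=
  forall x, Omega x -> differentiable u x /\ {for x, continuous (gradient u)}.

(* Main.v *)
Require Import Defs.
From mathcomp Require Import all_boot all_order all_algebra.
From mathcomp Require Import all_classical all_reals all_analysis.
From mathcomp Require Import measurable_realfun.
From mathcomp Require Import ring lra zify.

Set Implicit Arguments.
Unset Strict Implicit.
Unset Printing Implicit Defensive.

Local Open Scope classical_set_scope.
Local Open Scope ring_scope.

(** The proof never integrates over the n-dimensional space. Averages of u are
    finite averages over the points of a fine grid, and volumes are numbers of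
    grid points in dyadic cubes.

    Write f = |grad u|, H for the delta-content and q = delta/n, so q <= 1.
    Fix t > 0. For every i cover the set where f > 2^i t by dyadic cubes, almost
    optimally for H ([dyadic_cover]), and give a cube P of level i the weight
    2^(i q) l(P)^delta, where l is the side. A dyadic cube Q is called heavy if
    the weights of the cubes contained in Q add up to at least l(Q)^delta. Two
    facts make this notion useful.

    - The heavy cubes are small in total. Maximal heavy cubes are disjoint, so
      the sum of their l^delta is at most the total weight. Hence the points at
      distance at most L l(Q) from some heavy Q form a set of content at most a
      constant times L^delta times the total weight
      ([hausdorff_content_heavy]).
    - If no cube containing Q is heavy, then the average of f over Q is at most
      a constant times t ([light_level_sum]). Indeed the cubes P of the covers
      that meet Q lie in Q, the numbers w = 2^i (l(P)/l(Q))^n satisfy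
      sum w^q < 1, and w <= w^q because q <= 1, so sum w < 1.

    In a John domain every x is joined to the centre x0 by a chain of cubes with
    about beta/alpha members of each side 2^m, each at distance at most a
    constant times (beta/alpha) 2^m from x. If all cubes in the chain satisfy
    the average bound, consecutive grid averages of u differ by at most a
    constant times 2^m t ([grid_mean_step], a discrete Poincare inequality),
    and summing over m gives |u(x) - b| <= C beta t, where b is a limit value
    of the grid averages over one cube at x0. Therefore |u(x) - b| > C beta t
    forces a heavy cube near x ([john_oscillation]), and the first fact yields

      H(|u - b| > C beta t)
        <= C (beta/alpha)^delta sum_i 2^(i q) H(f > 2^i t)      ([weak_type]).

    Integrating over the levels t^p, the i-th summand contributes
    2^(i (q - p)) beta^p times the Choquet integral of f^p
    ([integral_le_dilation_series]). The geometric series converges exactly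
    because p > delta/n. Finally (beta/alpha)^delta is at most
    (beta/alpha)^(2np), since beta/alpha >= 1 and delta < np. *)

(** * Integrals of nonincreasing functions *)

Section nonincreasing_integrals.
Context {R : realType}.
Implicit Types (F G : R -> \bar R) (D : set R).
Local Open Scope ereal_scope.
Local Notation leb := (@lebesgue_measure R).

Lemma nonincreasing_emeasurable F D : measurable D ->
  (forall s t, (s <= t)%R -> F t <= F s) -> measurable_fun D (F : R -> \bar R).
Proof.
move=> mD niF; apply: (measurability _ (ErealGenOInfty.measurableE R)).
move=> _ [_ [r ->] <-]; apply: measurableI => //.
apply: is_interval_measurable => s t/=.
rewrite !in_itv/= !andbT => Fs Ft u /andP[su ut].
by rewrite in_itv/= andbT (lt_le_trans Ft)// niF.
Qed.

Definition dilation (c : R) : measurableTypeR R -> measurableTypeR R := *%R c.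

Lemma measurable_dilation c : measurable_fun setT (dilation c).
Proof. by rewrite /dilation; exact: mulrl_measurable. Qed.

(** Packaged as a measure so that the change of variables for push-forwards
    applies to it. *)
Definition dilated_lebesgue (c : R) :
    {measure set (measurableTypeR R) -> \bar R} :=
  measure_function_pushforward__canonical__measure_function_Measure leb
    (measurable_dilation c).

Lemma lebesgue_measure_dilation (c : R) (c0 : (0 <= c)%R) (A : set R) :
  (0 < c)%R -> measurable A ->
  leb A = mscale (NngNum c0) (dilated_lebesgue c) A.
Proof.
move=> cp mA; apply: lebesgue_measure_unique => //= _ [[a b]] _ <-.
rewrite /mscale /= /pushforward /=.
rewrite (_ : _ @^-1` _ = `](a / c)%R, (b / c)%R]%classic); last first.
  apply/seteqP; split => x /=; rewrite !in_itv/= ltr_pdivrMr// ler_pdivlMr//;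
    by rewrite /dilation (mulrC c).
rewrite !lebesgue_measure_itv/= !lte_fin ltr_pM2r ?invr_gt0//.
case: ifPn => _; last by rewrite mule0.
rewrite -!EFinD -EFinM; congr EFin; field; by rewrite gt_eqF.
Qed.

Lemma integral_dilation (c : R) F : (0 < c)%R -> (forall t, 0 <= F t) ->
  (forall s t, (s <= t)%R -> F t <= F s) ->
  \int[leb]_(t in `[0%R, +oo[) F (t * c)%R
    = (c^-1)%:E * \int[leb]_(t in `[0%R, +oo[) F t.
Proof.
move=> c0 F0 niF.
have mF D : measurable D -> measurable_fun D F.
  by move=> mD; exact: nonincreasing_emeasurable.
have mI : measurable (`[0%R, +oo[%classic : set R) by [].
have -> : \int[leb]_(t in `[0%R, +oo[) F t =
    \int[mscale (NngNum (ltW c0)) (dilated_lebesgue c)]_(t in `[0%R, +oo[) F t.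
  apply: eq_measure_integral => A mA _.
  exact: (lebesgue_measure_dilation (ltW c0) c0 mA).
rewrite ge0_integral_mscale//; last exact: mF.
rewrite muleA -EFinM mulVf ?gt_eqF// mul1e.
rewrite (@ge0_integral_pushforward _ _ _ _ _ _ (measurable_dilation c))//;
  last exact: mF.
rewrite (_ : _ @^-1` _ = `[0%R, +oo[%classic); last first.
  by apply/seteqP; split => x /=; rewrite !in_itv/= !andbT pmulr_rge0.
by apply: eq_integral => x _ /=; rewrite mulrC.
Qed.

(** Turns a distributional inequality, in which the levels on the right are
    rescaled by factors mu_i, into an inequality of integrals: the substitution
    t -> t mu_i costs 1 / mu_i, and everything is nonnegative, so sum and
    integral commute. Level 0, where the hypothesis may fail, is a null set. *)
Lemma integral_le_dilation_series F G (a mu : nat -> R) :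
  (forall t, 0 <= F t) -> (forall t, 0 <= G t) ->
  (forall s t, (s <= t)%R -> F t <= F s) ->
  (forall s t, (s <= t)%R -> G t <= G s) ->
  (forall i, (0 < a i)%R) -> (forall i, (0 < mu i)%R) ->
  (forall t, (0 < t)%R -> G t <= \sum_(i <oo) (a i)%:E * F (t * mu i)%R) ->
  \int[leb]_(t in `[0%R, +oo[) G t <=
  (\sum_(i <oo) (a i / mu i)%:E) * \int[leb]_(t in `[0%R, +oo[) F t.
Proof.
move=> F0 G0 niF niG a_gt0 mu0 GF.
have a0 i : (0 <= a i)%R := ltW (a_gt0 i).
have mG D : measurable D -> measurable_fun D G.
  by move=> mD; exact: nonincreasing_emeasurable.
have niFi i s t : (s <= t)%R -> F (t * mu i)%R <= F (s * mu i)%R.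
  by move=> st; apply: niF; rewrite ler_pM2r.
have mFi i D : measurable D ->
    measurable_fun D (fun t => (a i)%:E * F (t * mu i)%R).
  move=> mD; apply: nonincreasing_emeasurable => // s t st.
  by rewrite lee_wpmul2l ?lee_fin// niFi.
have Fi0 i t : 0 <= (a i)%:E * F (t * mu i)%R by rewrite mule_ge0 ?lee_fin.
have amu0 i : 0 <= (a i / mu i)%:E by rewrite lee_fin divr_ge0// ltW.
have [->|X_fin] := eqVneq (\int[leb]_(t in `[0%R, +oo[) F t) +oo.
  rewrite gt0_muley ?leey//; apply: lt_le_trans (nneseries_lim_ge 1 _).
  - by rewrite big_nat1 lte_fin divr_gt0.
  - by [].
have {}X_fin : \int[leb]_(t in `[0%R, +oo[) F t \is a fin_num.
  by rewrite ge0_fin_numE ?ltey//; exact: integral_ge0.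
rewrite -integral_itv_obnd_cbnd; last exact: mG.
apply: (@le_trans _ _ (\int[leb]_(t in `]0%R, +oo[)
    \sum_(i <oo) (a i)%:E * F (t * mu i)%R)).
  apply: ge0_le_integral => //.
  - exact: mG.
  - by apply: ge0_emeasurable_sum => // i _; exact: mFi.
  - by move=> x /=; rewrite in_itv/= andbT => /GF.
rewrite integral_nneseries//; last by move=> i; exact: mFi.
rewrite muleC -(fineK X_fin) -nneseriesZl//.
apply: lee_nneseries; [by move=> i _ _; exact: integral_ge0|move=> i _].
rewrite integral_itv_obnd_cbnd; last exact: mFi.
rewrite ge0_integralZl//; last 2 first.
- by apply: nonincreasing_emeasurable => // s t; apply: niFi.
- by rewrite lee_fin.
by rewrite integral_dilation// fineK// muleA -EFinM muleC.
Qed.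

End nonincreasing_integrals.

(** * Euclidean norm and dyadic cubes *)

Section euclidean_norm.
Context {R : realType} {n : nat}.
Implicit Types (v w : 'rV[R]_n) (r : R).

Lemma norm2_ge0 v : 0 <= norm2 v.
Proof. exact: sqrtr_ge0. Qed.

Lemma coord_le_norm2 v i : `|v ord0 i| <= norm2 v.
Proof.
rewrite -sqrtr_sqr ler_wsqrtr// (bigD1 i)//= lerDl sumr_ge0// => j _.
exact: sqr_ge0.
Qed.

Lemma norm_le_coord v r : 0 <= r -> (forall i, `|v ord0 i| <= r) -> `|v| <= r.
Proof.
move=> r0 h; rewrite /Num.Def.normr/= mx_normrE.
by apply/bigmax_leP; split => // -[i j] _ /=; rewrite ord1.
Qed.

Lemma coord_le_norm v i : `|v ord0 i| <= `|v|.
Proof.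
rewrite /Num.Def.normr/= mx_normrE.
exact: (le_bigmax _ (fun ij => `|v ij.1 ij.2|) (ord0, i)).
Qed.

Lemma norm_le_norm2 v : `|v| <= norm2 v.
Proof. by apply: norm_le_coord (norm2_ge0 v) _ => i; exact: coord_le_norm2. Qed.

(** The factor n is not sharp (sqrt n would do); the constants that depend on n
    are not tracked. *)
Lemma norm2_le v : norm2 v <= n%:R * `|v|.
Proof.
have nv0 : 0 <= n%:R * `|v| by rewrite mulr_ge0.
rewrite -[leRHS]ger0_norm// -sqrtr_sqr ler_wsqrtr//.
apply: (@le_trans _ _ (n%:R * `|v| ^+ 2)).
  rewrite mulr_natl -[X in _ <= _ *+ X]card_ord -sumr_const ler_sum// => i _.
  by rewrite -real_normK ?num_real// lerXn2r ?nnegrE// coord_le_norm.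
rewrite exprMn ler_wpM2r ?sqr_ge0//.
by rewrite -natrX ler_nat; case: (n) => // k; rewrite -mulnn leq_pmulr.
Qed.

End euclidean_norm.

Section dyadic_cubes.
Context {R : realType} {n : nat}.
Implicit Types (m : int) (x y z : 'rV[R]_n) (Q P : int * 'rV[int]_n).

Definition dyadic m : R := 2 ^ m.

Lemma dyadic_gt0 m : 0 < dyadic m.
Proof. exact: exprz_gt0. Qed.

Lemma dyadic_ge0 m : 0 <= dyadic m.
Proof. exact/ltW/dyadic_gt0. Qed.

Lemma dyadic_neq0 m : dyadic m != 0.
Proof. by rewrite gt_eqF// dyadic_gt0. Qed.

Lemma dyadicD m k : dyadic (m + k) = dyadic m * dyadic k.
Proof. by rewrite /dyadic expfzDr. Qed.

Lemma dyadicS m : dyadic (m + 1) = 2 * dyadic m.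
Proof. by rewrite dyadicD mulrC. Qed.

Lemma dyadic_nat (j : nat) : dyadic j%:Z = (2 ^ j)%:R.
Proof. by rewrite /dyadic -exprnP natrX. Qed.

Definition cube_index m y : 'rV[int]_n :=
  \row_i Num.floor (y ord0 i / dyadic m).

(** Half-open cubes, so that those of one scale partition the space. *)
Definition cube Q : set 'rV[R]_n := [set y | cube_index Q.1 y = Q.2].

Definition side Q : R := dyadic Q.1.

Definition corner Q : 'rV[R]_n := \row_i ((Q.2 ord0 i)%:~R * side Q).

Definition cube_of m y : int * 'rV[int]_n := (m, cube_index m y).

Lemma cube_ofP m y : cube (cube_of m y) y.
Proof. by []. Qed.

Lemma cubeP Q y : cube Q y <->
  forall i, (Q.2 ord0 i)%:~R * side Q <= y ord0 i
            < (Q.2 ord0 i + 1)%:~R * side Q.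
Proof.
split=> [/= <- i|h].
  rewrite !mxE; set k := Num.floor _.
  have := eqxx k; rewrite {1}/k floor_eq => /andP[].
  by rewrite ler_pdivlMr ?dyadic_gt0// ltr_pdivrMr ?dyadic_gt0// => -> ->.
apply/rowP => i; rewrite mxE; apply/eqP; rewrite floor_eq.
by rewrite ler_pdivlMr ?dyadic_gt0// ltr_pdivrMr ?dyadic_gt0//; exact: h.
Qed.

Lemma corner_cube Q : cube Q (corner Q).
Proof.
apply/cubeP => i; rewrite mxE lexx/= ltr_pM2r ?dyadic_gt0// ltr_int.
by rewrite ltzD1.
Qed.

Lemma cube_dist Q y z : cube Q y -> cube Q z -> `|y - z| <= side Q.
Proof.
move=> /cubeP Qy /cubeP Qz; apply: norm_le_coord; first exact: dyadic_ge0.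
move=> i; rewrite !mxE; move: (Qy i) (Qz i).
by rewrite rmorphD/= mulrDl mul1r ler_norml => /andP[? ?] /andP[? ?]; lra.
Qed.

(** Everything about nested dyadic cubes comes from this fact: the index at a
    coarser scale is the floor of the index divided by 2^j, so it depends only
    on the cube and not on the point. *)
Lemma cube_index_coarser m (j : nat) y z :
  cube_index m y = cube_index m z ->
  cube_index (m + j%:Z) y = cube_index (m + j%:Z) z.
Proof.
move=> /rowP yz; apply/rowP => i; have {yz} := yz i; rewrite !mxE => yz.
rewrite dyadicD dyadic_nat !invfM !mulrA.
set a := _ / dyadic m in yz *; set b := _ / dyadic m in yz *.
set K := Num.floor (b / _); have := eqxx K; rewrite {1}/K floor_eq.
have p0 : 0 < (2 ^ j)%:R :> R by rewrite ltr0n expn_gt0.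
rewrite ler_pdivlMr// ltr_pdivrMr// => /andP[Kb bK].
apply/eqP; rewrite floor_eq ler_pdivlMr// ltr_pdivrMr//.
have := eqxx (Num.floor a); rewrite {1}yz floor_eq => /andP[fb bf].
have := eqxx (Num.floor a); rewrite floor_eq => /andP[fa af].
set k := Num.floor a in fa af fb bf.
have {}Kb : (K * (2 ^ j)%N%:Z < k + 1)%R.
  by rewrite -(ltr_int R) intrM; apply: le_lt_trans Kb _.
have {}bK : (k < (K + 1) * (2 ^ j)%N%:Z)%R.
  by rewrite -(ltr_int R) intrM; apply: le_lt_trans bK.
apply/andP; split.
  apply: le_trans fa; rewrite (_ : (2 ^ j)%:R = (2 ^ j)%N%:Z%:~R)//.
  by rewrite -intrM ler_int -ltzD1.
apply: lt_le_trans af _.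
by rewrite (_ : (2 ^ j)%:R = (2 ^ j)%N%:Z%:~R)// -intrM ler_int lezD1.
Qed.

Lemma cube_nested P Q y : P.1 <= Q.1 -> cube P y -> cube Q y ->
  cube P `<=` cube Q.
Proof.
move=> PQ Py Qy z Pz; rewrite /cube/= -Qy.
have -> : Q.1 = P.1 + `|Q.1 - P.1|%N%:Z.
  by rewrite gez0_abs ?subr_ge0// addrCA subrr addr0.
by apply: cube_index_coarser; rewrite Pz.
Qed.

Lemma cube_eq P Q y : P.1 = Q.1 -> cube P y -> cube Q y -> P = Q.
Proof.
by case: P Q => [m k] [m' k'] /= ->; rewrite /cube/= => <- <-.
Qed.

Lemma cube_of_corner Q : cube_of Q.1 (corner Q) = Q.
Proof. by apply: (@cube_eq _ _ (corner Q)) => //; exact: corner_cube. Qed.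

End dyadic_cubes.
Arguments dyadic {R}.

(** * Heavy cubes and Hausdorff content *)

Section esum_complements.
Context {R : realType}.
Local Open Scope ereal_scope.

Lemma subset_esum (T : choiceType) (A B : set T) (a : T -> \bar R) :
  A `<=` B -> (forall t, 0 <= a t) ->
  \esum_(t in A) a t <= \esum_(t in B) a t.
Proof.
move=> AB a0; rewrite [leRHS](esumID A)//.
by rewrite (setIidr AB) leeDl// esum_ge0.
Qed.

Lemma esumZ_le (T : choiceType) (A : set T) (c : R) (a : T -> R) :
  (0 <= c)%R -> (forall t, (0 <= a t)%R) ->
  \esum_(t in A) (c * a t)%:E <= c%:E * \esum_(t in A) (a t)%:E.
Proof.
move=> c0 a0; apply: ge_ereal_sup => _ [X [finX XA] <-].
rewrite fsbig_finite//= -(big_morph EFin (@EFinD _) erefl) -mulr_sumr EFinM.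
rewrite lee_wpmul2l ?lee_fin//; apply: ereal_sup_ubound; exists X => //.
by rewrite fsbig_finite//= -(big_morph EFin (@EFinD _) erefl).
Qed.

Lemma esum_ge_seq (T : choiceType) (A : set T) (a : T -> \bar R) (s : seq T) :
  (forall t, 0 <= a t) -> uniq s -> (forall t, t \in s -> A t) ->
  \sum_(t <- s) a t <= \esum_(t in A) a t.
Proof.
move=> a0 us sA; apply: esum_ge; exists [set` s]; first by split.
by rewrite fsbig_seq.
Qed.

End esum_complements.

Section hausdorff_content_bounds.
Context {R : realType} {n : nat}.
Implicit Types (E F : set 'rV[R]_n) (delta : R).
Local Open Scope ereal_scope.

Lemma hausdorff_content_ge0 delta E : 0 <= hausdorff_content delta E.
Proof.
apply: le_ereal_inf_tmp => _ [D [x [r [_ _ ->]]]].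
by apply: esum_ge0 => i _; rewrite lee_fin powR_ge0.
Qed.

Lemma le_hausdorff_content delta E F : E `<=` F ->
  hausdorff_content delta E <= hausdorff_content delta F.
Proof.
move=> EF; apply: le_ereal_inf => _ [D [x [r [r0 FB ->]]]].
by exists D, x, r; split => //; apply: subset_trans FB.
Qed.

(** The definition of the content indexes balls by natural numbers; an
    arbitrary countable family is transported along its enumeration. *)
Lemma hausdorff_content_le_balls delta E (T : countType) (D : set T)
    (x : T -> 'rV[R]_n) (r : T -> R) :
  (forall t, D t -> (0 < r t)%R) ->
  E `<=` \bigcup_(t in D) ball2 (x t) (r t) ->
  hausdorff_content delta E <= \esum_(t in D) (r t `^ delta)%:E.
Proof.
move=> r0 ED; apply: ereal_inf_lbound.
exists (pickle @` D), (fun a => oapp x 0%R (unpickle a)),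
  (fun a => oapp r 0%R (unpickle a)); split.
- by move=> _ [t Dt <-]; rewrite pickleK; exact: r0.
- move=> y /ED[t Dt ty]; exists (pickle t); first by exists t.
  by rewrite pickleK.
rewrite esum_image; last by move=> s t _ _; exact: (pcan_inj pickleK).
by apply: eq_esum => t _; rewrite pickleK.
Qed.

End hausdorff_content_bounds.

Section maximal_cubes.
Context {R : realType} {n : nat} (delta : R).
Hypothesis delta_gt0 : 0 < delta.
Local Notation cubeT := (int * 'rV[int]_n)%type.
Implicit Types P Q : cubeT.

(** Inclusion of dyadic cubes in a combinatorial form: the order of the scales
    is recorded, and by nestedness a single common point suffices. *)
Definition subcube P Q : Prop := P.1 <= Q.1 /\ cube Q (corner P : 'rV[R]_n).

Lemma subcube_refl Q : subcube Q Q.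
Proof. by split => //; exact: corner_cube. Qed.

Lemma subcube_sub P Q : subcube P Q -> cube P `<=` (cube Q : set 'rV[R]_n).
Proof. by move=> [PQ Qc]; apply: cube_nested PQ _ Qc; exact: corner_cube. Qed.

Lemma subcube_trans P Q S : subcube P Q -> subcube Q S -> subcube P S.
Proof.
move=> [PQ Qc] QS; split; first exact: le_trans PQ QS.1.
exact: (subcube_sub QS).
Qed.

Lemma subcube_meet P Q (y : 'rV[R]_n) : P.1 <= Q.1 -> cube P y -> cube Q y ->
  subcube P Q.
Proof.
move=> PQ Py Qy; split=> //.
by apply: (cube_nested PQ Py Qy); exact: corner_cube.
Qed.

Context (T : choiceType) (J : set T) (P : T -> cubeT) (w : T -> R).
Hypothesis w_ge0 : forall a, 0 <= w a.

Definition heavy Q : Prop :=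
  (((side Q : R) `^ delta)%:E
    <= \esum_(a in J `&` [set a | subcube (P a) Q]) (w a)%:E)%E.

Let W : \bar R := (\esum_(a in J) (w a)%:E)%E.

Lemma heavy_side Q : heavy Q -> (((side Q : R) `^ delta)%:E <= W)%E.
Proof.
move=> /le_trans; apply; apply: subset_esum => [a []//|a].
by rewrite lee_fin.
Qed.

Definition maximal_heavy Q : Prop :=
  heavy Q /\ forall Q', heavy Q' -> subcube Q Q' -> Q' = Q.

(** The heavy ancestors of a heavy cube have bounded side, because l^delta of a
    heavy cube is at most the finite total weight W; so there is a largest
    one. *)
Lemma maximal_heavy_exists Q : W \is a fin_num -> heavy Q ->
  exists2 Q', maximal_heavy Q' & subcube Q Q'.
Proof.
move=> Wfin hQ; pose c : 'rV[R]_n := corner Q.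
pose anc (j : nat) := cube_of (Q.1 + j%:Z) c.
have anc0 : anc 0%N = Q by rewrite /anc addr0 cube_of_corner.
have [B hB] : exists B : nat, forall j, `[< heavy (anc j) >] -> (j <= B)%N.
  (* If the ancestor j steps above Q is heavy, then j < 2^j <= r. *)
  pose r := (fine W) `^ delta^-1 / dyadic Q.1.
  exists (Num.bound r) => j /asboolP /heavy_side.
  rewrite -(fineK Wfin) lee_fin => h.
  have {}h : side (anc j) <= fine W `^ delta^-1.
    have := @ge0_ler_powR R delta^-1 _ _ _ _ _ h.
    rewrite -powRrM divff ?gt_eqF// powRr1 ?dyadic_ge0//; apply.
    - by rewrite invr_ge0 ltW.
    - by rewrite nnegrE powR_ge0.
    - by rewrite nnegrE (le_trans _ h)// powR_ge0.
  have jr : j%:R < r :> R.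
    rewrite ltr_pdivlMr ?dyadic_gt0//; apply: lt_le_trans h.
    rewrite /side/= dyadicD dyadic_nat mulrC ltr_pM2l ?dyadic_gt0//.
    by rewrite ltr_nat ltn_expl.
  have r0 : 0 <= r by rewrite divr_ge0 ?powR_ge0 ?dyadic_ge0.
  by rewrite -(ler_nat R) ltW// (lt_trans jr)// archi_boundP.
have ex0 : exists j, `[< heavy (anc j) >].
  by exists 0%N; apply/asboolP; rewrite anc0.
have [i /asboolP hi imax] := ex_maxnP ex0 hB.
have Qi : subcube Q (anc i).
  by split; [rewrite lerDl|exact: cube_ofP].
exists (anc i) => //; split=> // Q' hQ' iQ'.
have Qc : cube Q' c := (subcube_trans Qi iQ').2.
have Q1 := (subcube_trans Qi iQ').1.
have Q'E : Q' = anc `|Q'.1 - Q.1|%N.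
  apply: (@cube_eq _ _ _ _ c) => //=.
  by rewrite gez0_abs ?subr_ge0// addrCA subrr addr0.
apply: (@cube_eq _ _ _ _ c) => //; apply/eqP; rewrite eq_le iQ'.1 andbT.
rewrite Q'E/= lerD2l lez_nat; apply: imax; apply/asboolP.
by rewrite -Q'E.
Qed.

(** Two maximal heavy cubes with a common subcube are nested, hence equal. *)
Lemma maximal_heavy_disjoint Q Q' S : maximal_heavy Q -> maximal_heavy Q' ->
  subcube S Q -> subcube S Q' -> Q = Q'.
Proof.
move=> [hQ mQ] [hQ' mQ'] [SQ cQ] [SQ' cQ'].
have [QQ'|QQ'] := orP (le_total Q.1 Q'.1).
  by apply/esym/mQ => //; exact: subcube_meet cQ'.
by apply/mQ' => //; exact: subcube_meet cQ.
Qed.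

(** Each weighted cube lies in at most one maximal heavy cube, so the weights
    that make these cubes heavy are disjoint parts of the total weight. *)
Lemma maximal_heavy_esum :
  (\esum_(Q in maximal_heavy) ((side Q : R) `^ delta)%:E <= W)%E.
Proof.
apply: (@le_trans _ _ (\esum_(Q in maximal_heavy)
    \esum_(a in J `&` [set a | subcube (P a) Q]) (w a)%:E)%E).
  by apply: le_esum => Q [].
rewrite esum_esum; last by move=> Q a _ _; rewrite lee_fin.
rewrite -(esum_image _ snd (fun a => (w a)%:E)); last first.
  move=> [Q a] [Q' a'] /set_mem[/= mQ [_ aQ]] /set_mem[/= mQ' [_ aQ']] /= aa'.
  rewrite -aa' in aQ' *; congr pair.
  exact: maximal_heavy_disjoint aQ aQ'.
apply: subset_esum => [a [[Q a'] [_ [Ja' _]] <-]//|a].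
by rewrite lee_fin.
Qed.

(** A point within L l(Q) of a heavy cube Q is within (L + 1) l(Q') of the
    maximal heavy cube Q' above Q. The balls of radius 2 n L l(Q'), one for each
    maximal Q', form the required covering. *)
Lemma hausdorff_content_heavy (L : R) : (0 < n)%N -> 1 < L ->
  (hausdorff_content delta
     [set x : 'rV[R]_n | exists2 Q, heavy Q & (`|x - corner Q| <= L * side Q)%R]
   <= ((2 * n%:R * L) `^ delta)%:E * W)%E.
Proof.
move=> n0 L1; have L0 : 0 < L by apply: lt_trans L1.
have K0 : 0 < 2 * n%:R * L by rewrite !mulr_gt0// ltr0n.
have [Wfin|Winf] := boolP (W \is a fin_num); last first.
  have -> : W = +oo%E.
    apply: contraNeq Winf => Winf; rewrite ge0_fin_numE ?ltey//.
    by apply: esum_ge0 => a _; rewrite lee_fin.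
  by rewrite gt0_muley ?leey// lte_fin powR_gt0.
apply: (@le_trans _ _ (\esum_(Q in maximal_heavy)
    ((2 * n%:R * L * side Q) `^ delta)%:E)%E).
  apply: (@hausdorff_content_le_balls R n delta _ cubeT _ corner
    (fun Q => 2 * n%:R * L * side Q)) => [Q _|x [Q hQ xQ]].
    by rewrite mulr_gt0// dyadic_gt0.
  have [Q' mQ' [QQ' cQ']] := maximal_heavy_exists Wfin hQ.
  exists Q' => //; rewrite /ball2/=; apply: le_lt_trans (norm2_le _) _.
  have sQQ' : side Q <= side Q' :> R by rewrite ler_eXz2l// ltr1n.
  have := ler_distD (corner Q) x (corner Q').
  have := cube_dist cQ' (corner_cube Q').
  have s0 : 0 < side Q' :> R := dyadic_gt0 _.
  have n0' : 0 < n%:R :> R by rewrite ltr0n.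
  move=> d1 d2.
  rewrite (_ : 2 * n%:R * L * side Q' = n%:R * (2 * L * side Q')); last by ring.
  rewrite ltr_pM2l//; apply: le_lt_trans d2 _.
  have : L * side Q <= L * side Q' by rewrite ler_wpM2l// ltW.
  have : side Q' < L * side Q' by rewrite ltr_pMl.
  lra.
apply: le_trans (lee_wpmul2l _ maximal_heavy_esum);
  last by rewrite lee_fin powR_ge0.
under eq_esum do rewrite powRM ?dyadic_ge0 ?(ltW K0)//.
by apply: esumZ_le => [|Q]; exact: powR_ge0.
Qed.

End maximal_cubes.

(** * Coverings by dyadic cubes *)

Lemma continuous_norm2 (R : realType) (n : nat) : continuous (@norm2 R n).
Proof.
have sq : continuous (fun v : 'rV[R]_n => \sum_(i < n) v ord0 i ^+ 2).
  apply: continuous_big => [|i _ w]; first exact: add_continuous.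
  apply: (@continuous_comp _ _ _ (fun v : 'rV[R]_n => v ord0 i)
    (fun t : R => t ^+ 2)); first exact: coord_continuous.
  exact: exprn_continuous.
by move=> v; apply: continuous_comp (sq v) _; exact: sqrt_continuous.
Qed.

Lemma dyadic_scale (R : realType) (r : R) : 0 < r ->
  exists m, r <= dyadic m <= 2 * r.
Proof.
move=> r0; have ln2 : 0 < ln 2 :> R by rewrite ln_gt0// ltr1n.
exists (Num.ceil (ln r / ln 2)); rewrite /dyadic -powR_intmul//.
set m : R := (Num.ceil _)%:~R.
have p2 x : 2 `^ x = expR (x * ln 2) :> R by rewrite /powR pnatr_eq0.
have -> : 2 * r = expR (ln 2 + ln r) :> R by rewrite expRD !lnK ?posrE.
rewrite p2 -{1}(lnK (_ : r \in Num.pos)) ?posrE// !ler_expR.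
rewrite -ler_pdivrMr// ceil_ge/= -[X in _ <= X + _]mul1r -ler_pdivlMr// mulrDl.
rewrite mul1r divff ?gt_eqF//.
have := ceilB1_lt (ln r / ln 2); rewrite intrB/= -/m => ?; lra.
Qed.

(** The difference is encoded as e - 1 so that the index shifts around a cube
    form the finite type {ffun 'I_n -> 'I_3}. *)
Lemma floor_near (R : realType) (a b : R) : `|a - b| < 1 ->
  exists e : 'I_3, Num.floor a = Num.floor b + (e%:Z - 1).
Proof.
rewrite ltr_distl => /andP[ab ba].
have := eqxx (Num.floor a); rewrite floor_eq => /andP[].
have := eqxx (Num.floor b); rewrite floor_eq => /andP[].
move: (Num.floor a) (Num.floor b) => k l lb bl ka ak.
have h1 : (k < l + 2).
  rewrite -(ltr_int R) intrD; move: bl; rewrite !intrD => bl; lra.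
have h2 : (l < k + 2).
  rewrite -(ltr_int R) intrD; move: ak; rewrite !intrD => ak; lra.
have h3 : (absz (k - l + 1)%R < 3)%N by lia.
by exists (Ordinal h3) => /=; lia.
Qed.

Section dyadic_cover.
Context {R : realType} {n : nat} (delta : R).
Hypothesis delta_ge0 : 0 <= delta.

(** A ball of radius r is covered by the 3^n cubes around its centre whose side
    is the power of 2 between r and 2 r. The finite list l makes the covering
    locally uniform: the balls are open, so all points near z are covered by the
    cubes that replace one single ball. *)
Lemma dyadic_cover (E : set 'rV[R]_n) (s : R) :
  (hausdorff_content delta E < s%:E)%E ->
  exists (J : set (nat * {ffun 'I_n -> 'I_3}))
         (P : nat * {ffun 'I_n -> 'I_3} -> int * 'rV[int]_n),
    (\esum_(a in J) ((side (P a) : R) `^ delta)%:E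
       <= ((3 ^ n)%:R * 2 `^ delta * s)%:E)%E /\
    forall z, E z -> exists l : seq (nat * {ffun 'I_n -> 'I_3}),
      \forall z' \near z, exists2 a, a \in l & J a /\ cube (P a) z'.
Proof.
move=> /ereal_inf_lt[_ [D [x [r [r0 ED ->]]]] Ds].
have /choice[m hm] i : exists m, D i -> r i <= dyadic m <= 2 * r i.
  have [Di|nDi] := pselect (D i); last by exists 0.
  by have [m ?] := dyadic_scale (r0 _ Di); exists m.
pose P (a : nat * {ffun 'I_n -> 'I_3}) : int * 'rV[int]_n :=
  (m a.1, \row_k (cube_index (m a.1) (x a.1) ord0 k + ((a.2 k)%:Z - 1))).
exists (D `*`` fun=> setT), P; split.
  rewrite -(@esum_esum _ _ _ D (fun=> setT)
     (fun i e => ((side (P (i, e)) : R) `^ delta)%:E)); last first.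
    by move=> i e _ _; rewrite lee_fin powR_ge0.
  apply: (@le_trans _ _ (\esum_(i in D)
      ((3 ^ n)%:R * 2 `^ delta * (r i `^ delta))%:E)%E).
    apply: le_esum => i Di.
    rewrite (_ : [set: {ffun 'I_n -> 'I_3}] =
      [set` enum {ffun 'I_n -> 'I_3}]); last first.
      by apply/seteqP; split => e //= _; rewrite mem_enum.
    rewrite esum_fset; [|exact: finite_seq|by move=> e _; rewrite lee_fin powR_ge0].
    rewrite -fsbig_seq ?enum_uniq// sumEFin lee_fin.
    rewrite (eq_bigr (fun=> (dyadic (m i) : R) `^ delta))// big_const_seq count_predT.
    rewrite -cardE card_ffun !card_ord iter_addr_0 -[leLHS]mulr_natl -mulrA.
    have ri0 := ltW (r0 _ Di); rewrite ler_wpM2l// -powRM//.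
    by apply: ge0_ler_powR; rewrite ?nnegrE ?dyadic_ge0 ?mulr_ge0 //;
      have /andP[] := hm i Di.
  have C0 : 0 <= (3 ^ n)%:R * 2 `^ delta :> R by rewrite mulr_ge0// powR_ge0.
  apply: le_trans (esumZ_le D C0 (fun i => powR_ge0 (r i) delta)) _.
  by rewrite [in leRHS]EFinM lee_wpmul2l ?lee_fin//; exact: ltW.
move=> z /ED[i Di]; rewrite /ball2/= => zi.
exists [seq (i, e) | e <- enum {ffun 'I_n -> 'I_3}].
have : \forall z' \near z, norm2 (z' - x i) < r i.
  have c : {for z, continuous (fun z' : 'rV[R]_n => norm2 (z' - x i))}.
    apply: (@continuous_comp _ _ _ (fun z' : 'rV[R]_n => z' - x i) (@norm2 R n)).
      exact: (@cvgB R 'rV[R]_n _ (nbhs z) _ id (cst (x i)) z (x i)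
        cvg_id (cvg_cst _)).
    exact: continuous_norm2.
  exact: (cvgr_lt _ c).
apply: filterS => z' z'i.
have /fin_all_exists[e he] k : exists e : 'I_3,
    cube_index (m i) z' ord0 k = cube_index (m i) (x i) ord0 k + (e%:Z - 1).
  rewrite !mxE; apply: floor_near.
  rewrite -mulrBl normrM [X in _ * X]gtr0_norm ?invr_gt0 ?dyadic_gt0//.
  rewrite ltr_pdivrMr ?dyadic_gt0// mul1r.
  have := coord_le_norm2 (z' - x i) k; rewrite !mxE => h.
  apply: le_lt_trans h _; apply: lt_le_trans z'i _.
  by have /andP[] := hm i Di.
exists (i, finfun e); first by apply/mapP; exists (finfun e); rewrite ?mem_enum.
split; first by [].
by apply/rowP => k; rewrite he !mxE ffunE.
Qed.

End dyadic_cover.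

(** * A discrete Poincare inequality on the integer lattice *)

Section lattice_blocks.
Context {R : realFieldType} {n : nat}.
Local Notation lattice := 'rV[int]_n.
Implicit Types (k z : lattice) (w g : lattice -> R) (M : nat).

Definition block_point M k (v : {ffun 'I_n -> 'I_M}) : lattice :=
  \row_i (k ord0 i * M%:Z + (v i)%:Z).

Definition block_sum M k w : R := \sum_v w (@block_point M k v).

Definition unit_step i : lattice := delta_mx ord0 i.

(** Translation by s in direction i, wrapped around inside the block. *)
Definition cyclic_shift M (i : 'I_n) (s : nat) (v : {ffun 'I_n -> 'I_M.+1}) :
    {ffun 'I_n -> 'I_M.+1} :=
  [ffun j => if j == i then inord ((v j + s) %% M.+1) else v j].

Lemma cyclic_shift_inj M i s : injective (@cyclic_shift M i s).
Proof.
move=> v v' /ffunP vv'; apply/ffunP => j; have := vv' j; rewrite !ffunE.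
case: eqP => // _ /(congr1 val); rewrite /= !inordK ?ltn_pmod//.
move=> /eqP; rewrite eqn_modDr => /eqP.
by rewrite !modn_small// => /val_inj.
Qed.

(** A translate by s < M of a point of block k is either in block k or in the
    next block in direction i, and its offset there is the cyclic shift. *)
Lemma block_point_step M i (s : nat) k (v : {ffun 'I_n -> 'I_M.+1}) :
  (s < M.+1)%N ->
  block_point k v + unit_step i *+ s =
    block_point (if (v i + s < M.+1)%N then k else k + unit_step i)
      (cyclic_shift i s v).
Proof.
move=> sM; apply/rowP => j; rewrite !mxE mulmxnE !mxE !ffunE eqxx/=.
have [->|ji] := eqVneq j i; last first.
  by case: ifP => _; rewrite ?mxE ?(negbTE ji) ?eqxx/= ?mul0rn ?addr0.
rewrite inordK ?ltn_pmod//; have vM := ltn_ord (v i).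
case: ifPn => [h|h].
  by rewrite modn_small// PoszD -[_ *+ s]/(s%:R) natz addrA.
rewrite !mxE !eqxx/= -leqNgt in h *.
have -> : ((v i + s) %% M.+1 = v i + s - M.+1)%N.
  by rewrite -{1}(subnK h) modnDr modn_small//; lia.
by rewrite -subzn// PoszD -[_ *+ s]/(s%:R) natz; ring.
Qed.

(** Since the cyclic shift permutes the offsets, the translate of block k meets
    every point of the two blocks at most once. *)
Lemma block_sum_shift M i s k g : (s < M.+1)%N -> (forall z, 0 <= g z) ->
  \sum_v g (@block_point M.+1 k v + unit_step i *+ s) <=
    block_sum M.+1 k g + block_sum M.+1 (k + unit_step i) g.
Proof.
move=> sM g0; rewrite /block_sum -big_split/=.
rewrite [leRHS](reindex_inj (@cyclic_shift_inj M i s))/=.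
apply: ler_sum => v _; rewrite block_point_step//.
by case: ifP => _; [rewrite lerDl|rewrite lerDr].
Qed.

Definition increments_le M k w g : Prop :=
  forall i (v : {ffun 'I_n -> 'I_M}),
    `|w (block_point k v + unit_step i) - w (block_point k v)|
      <= g (block_point k v).

(** The one-dimensional fundamental theorem of calculus along each of the
    lattice lines that lead from block k to the next block. *)
Lemma block_sum_step M i k w g : (forall z, 0 <= g z) ->
  increments_le M.+1 k w g -> increments_le M.+1 (k + unit_step i) w g ->
  `|block_sum M.+1 (k + unit_step i) w - block_sum M.+1 k w| <=
    M.+1%:R * (block_sum M.+1 k g + block_sum M.+1 (k + unit_step i) g).
Proof.
move=> g0 hk hki; rewrite /block_sum -sumrB.
apply: le_trans (ler_norm_sum _ _ _) _.
apply: (@le_trans _ _ (\sum_v \sum_(0 <= s < M.+1)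
    g (@block_point M.+1 k v + unit_step i *+ s))).
  apply: ler_sum => v _.
  have -> : block_point (k + unit_step i) v =
      block_point k v + unit_step i *+ M.+1.
    apply/rowP => j; rewrite !mxE mulmxnE !mxE eqxx/=.
    by rewrite mulrDl pmulrn -mulrzl; ring.
  have -> : w (block_point k v + unit_step i *+ M.+1) - w (block_point k v) =
    \sum_(0 <= s < M.+1) (w (block_point k v + unit_step i *+ s.+1)
                          - w (block_point k v + unit_step i *+ s)).
    rewrite (telescope_sumr (fun s => w (block_point k v + unit_step i *+ s)))//.
    by rewrite mulr0n addr0.
  apply: le_trans (ler_norm_sum _ _ _) _.
  rewrite !big_mkord; apply: ler_sum => s _.
  rewrite mulrSr addrA block_point_step//.
  by case: ifP => _; [apply: hk|apply: hki].
rewrite exchange_big big_mkord/= mulr_natl; set S := (X in X *+ _).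
rewrite -[X in S *+ X]card_ord -sumr_const.
by apply: ler_sum => s _; exact: block_sum_shift.
Qed.

Definition adjacent_index k k' : Prop :=
  forall i, `|k' ord0 i - k ord0 i| <= 1.

(** The coordinates of k are changed into those of k' one after the other, so
    that each of the n steps is a step between blocks sharing a face. *)
Lemma block_sum_adjacent M k k' w g (G : R) : (forall z, 0 <= g z) ->
  (forall k'', adjacent_index k k'' ->
    increments_le M.+1 k'' w g /\ block_sum M.+1 k'' g <= G) ->
  adjacent_index k k' ->
  `|block_sum M.+1 k' w - block_sum M.+1 k w| <= n%:R * (M.+1%:R * (2 * G)).
Proof.
move=> g0 hG kk'.
pose kj (j : nat) : lattice :=
  \row_i (if (i < j)%N then k' ord0 i else k ord0 i).
have kkj j : adjacent_index k (kj j).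
  move=> i; rewrite !mxE; case: ifP => _; first exact: kk'.
  by rewrite subrr normr0.
have -> : k = kj 0%N by apply/rowP => i; rewrite mxE.
have -> : k' = kj n by apply/rowP => i; rewrite mxE ltn_ord.
have G0 : 0 <= G.
  apply: le_trans (hG _ (kkj 0%N)).2; apply: sumr_ge0 => v _; exact: g0.
have step j : (j < n)%N ->
    `|block_sum M.+1 (kj j.+1) w - block_sum M.+1 (kj j) w| <= M.+1%:R * (2 * G).
  move=> jn; pose i := Ordinal jn; have ij : nat_of_ord i = j by [].
  have up a b : adjacent_index k a -> adjacent_index k b -> b = a + unit_step i ->
      `|block_sum M.+1 b w - block_sum M.+1 a w| <= M.+1%:R * (2 * G).
    move=> ka kb ba; have [ha Ga] := hG _ ka; have [hb Gb] := hG _ kb.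
    rewrite ba in hb Gb *; apply: le_trans (block_sum_step g0 ha hb) _.
    by rewrite ler_wpM2l// mulr_natl mulr2n lerD.
  have [e0|[e1|e2]] : k' ord0 i = k ord0 i \/ k' ord0 i = k ord0 i + 1 \/
      k ord0 i = k' ord0 i + 1.
    by have := kk' i; lia.
  - have -> : kj j.+1 = kj j.
      apply/rowP => l; rewrite !mxE ltnS leq_eqVlt; case: eqP => //= lj.
      have -> : l = i by exact: val_inj.
      by rewrite e0; case: ifP.
    by rewrite subrr normr0 !mulr_ge0.
  - apply: up; [exact: kkj|exact: kkj|].
    apply/rowP => l; rewrite !mxE ltnS leq_eqVlt eqxx/=.
    have [->|li] := eqVneq l i; first by rewrite ij eqxx ltnn/= e1.
    have -> : (l == j :> nat) = false by apply/negbTE; rewrite -(inj_eq val_inj) in li.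
    by rewrite addr0.
  - rewrite distrC; apply: up; [exact: kkj|exact: kkj|].
    apply/rowP => l; rewrite !mxE [(l < j.+1)%N]ltnS [(l <= j)%N]leq_eqVlt eqxx/=.
    have [->|li] := eqVneq l i; first by rewrite ij eqxx ltnn/= e2.
    have -> : (l == j :> nat) = false by apply/negbTE; rewrite -(inj_eq val_inj) in li.
    by rewrite addr0.
suff H j : (j <= n)%N ->
    `|block_sum M.+1 (kj j) w - block_sum M.+1 (kj 0%N) w| <=
      j%:R * (M.+1%:R * (2 * G)) by exact: H.
elim: j => [|j IH] jn; first by rewrite subrr normr0 mul0r.
apply: le_trans (ler_distD (block_sum M.+1 (kj j) w) _ _) _.
rewrite -natr1 mulrDl mul1r addrC lerD// ?step//.
by apply: IH; exact: ltnW.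
Qed.

Definition child_index k (c : {ffun 'I_n -> 'I_2}) : lattice :=
  \row_i (k ord0 i * 2 + (c i)%:Z).

(** Writes the offsets below 2M uniquely as c M + v with c < 2 and v < M. *)
Lemma block_sum_children M k w :
  block_sum (2 * M) k w = \sum_c block_sum M (child_index k c) w.
Proof.
have lt2M (c : 'I_2) (v : 'I_M) : (c * M + v < 2 * M)%N.
  by have := ltn_ord c; have := ltn_ord v; case: c => -[|[|]]//= _; lia.
pose f (p : {ffun 'I_n -> 'I_2} * {ffun 'I_n -> 'I_M}) :
    {ffun 'I_n -> 'I_(2 * M)} := [ffun i => Ordinal (lt2M (p.1 i) (p.2 i))].
have finj : injective f.
  move=> [c v] [c' v'] /ffunP /= h.
  suff H i : c i = c' i /\ v i = v' i.
    by congr (_, _); apply/ffunP => i; case: (H i).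
  have /(congr1 val) := h i; rewrite !ffunE /= => e.
  have M0 : (0 < M)%N by apply: leq_ltn_trans (ltn_ord (v i)).
  split; apply: val_inj => /=.
    have := congr1 (divn^~ M) e.
    by rewrite !divnMDl// !divn_small ?ltn_ord// !addn0.
  by have := congr1 (modn^~ M) e; rewrite !modnMDl !modn_small ?ltn_ord.
have fbij : bijective f.
  apply: inj_card_bij finj _.
  by rewrite card_prod !card_ffun !card_ord expnMn.
rewrite /block_sum pair_big/= (reindex f); last exact: onW_bij.
apply: eq_bigr => -[c v] _; congr w; apply/rowP => i.
by rewrite !mxE !ffunE/= !PoszD !PoszM; ring.
Qed.

Lemma child_index_adjacent k c c' :
  adjacent_index (child_index k c) (child_index k c').
Proof.
move=> i; rewrite !mxE.
have := ltn_ord (c i); have := ltn_ord (c' i).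
by move: (nat_of_ord (c i)) (nat_of_ord (c' i)) => a b; lia.
Qed.

(** The sum over the large block is the sum over its 2^n children, each of which
    is adjacent to the child c. *)
Lemma block_sum_parent M k (c : {ffun 'I_n -> 'I_2}) w g (G : R) :
  (forall z, 0 <= g z) ->
  (forall k', adjacent_index (child_index k c) k' ->
    increments_le M.+1 k' w g /\ block_sum M.+1 k' g <= G) ->
  `|block_sum (2 * M.+1) k w - (2 ^ n)%:R * block_sum M.+1 (child_index k c) w|
    <= (2 ^ n)%:R * (n%:R * (M.+1%:R * (2 * G))).
Proof.
move=> g0 hG; rewrite block_sum_children.
have sumc (x : R) : (2 ^ n)%:R * x = \sum_(c' : {ffun 'I_n -> 'I_2}) x.
  by rewrite sumr_const card_ffun !card_ord mulr_natl.
rewrite !sumc -sumrB.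
apply: le_trans (ler_norm_sum _ _ _) _; apply: ler_sum => c' _.
exact: block_sum_adjacent g0 hG (child_index_adjacent _ _ _).
Qed.

Definition in_block M k : pred lattice :=
  [pred z : lattice | [forall i : 'I_n, (k ord0 i * M%:Z <= z ord0 i
                                        < (k ord0 i + 1) * M%:Z)]].

(** A volume bound: whatever block is summed over, a block of side N+1 has at
    most (N+1)^n points in it. *)
Lemma block_sum_in_block M k N k' :
  block_sum M k (fun z => (in_block N.+1 k' z)%:R) <= (N.+1 ^ n)%:R :> R.
Proof.
rewrite /block_sum -natr_sum ler_nat.
pose A := [set v | in_block N.+1 k' (@block_point M k v)]%SET.
have -> : (\sum_v in_block N.+1 k' (@block_point M k v) = #|A|)%N.
  rewrite -sum1_card [RHS]big_mkcond/=; apply: eq_bigr => v _.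
  by rewrite inE; case: in_block.
pose f (v : {ffun 'I_n -> 'I_M}) : {ffun 'I_n -> 'I_N.+1} :=
  [ffun i => inord (absz (block_point k v ord0 i - k' ord0 i * N.+1%:Z)%R)].
have finj : {in A &, injective f}.
  move=> v v'; rewrite !inE => /forallP hv /forallP hv' /ffunP vv'.
  apply/ffunP => i; have /(congr1 val) := vv' i; rewrite !ffunE/=.
  have := hv i; have := hv' i; rewrite !mxE => h' h.
  by rewrite !inordK; [move=> e; apply: val_inj => /=; lia|lia|lia].
rewrite -(card_in_imset finj).
by apply: leq_trans (max_card _) _; rewrite card_ffun !card_ord.
Qed.

End lattice_blocks.

(** * Increments of u on a fine grid *)

Section increments.
Context {R : realType} {n : nat}.
Implicit Types (u : 'rV[R]_n -> R) (z v : 'rV[R]_n).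

(** The difference quotients of the restriction to the line are literally those
    of the directional derivative. *)
Lemma is_derive_line u z v (s : R) : derivable u (z + s *: v) v ->
  is_derive s 1 (fun s => u (z + s *: v)) ('D_v u (z + s *: v)).
Proof.
move=> du; have E : (fun h : R => h^-1 *:
    (((fun s => u (z + s *: v)) \o shift s) (h *: 1) - u (z + s *: v))) =
  (fun h : R => h^-1 *: ((u \o shift (z + s *: v)) (h *: v) - u (z + s *: v))).
  apply/funext => h /=; congr (_ *: (u _ - _)).
  by rewrite [h *: 1]mulr1 scalerDl addrCA.
by apply: DeriveDef; rewrite /derivable /derive E.
Qed.

Lemma increment_le u z i (h B : R) : 0 <= h ->
  (forall s, 0 <= s <= h -> differentiable u (z + s *: delta_mx ord0 i) /\
     norm2 (gradient u (z + s *: delta_mx ord0 i)) <= B) ->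
  `|u (z + h *: delta_mx ord0 i) - u z| <= h * B.
Proof.
move=> h0 hB; pose g (s : R) := u (z + s *: delta_mx ord0 i).
have dg s : 0 <= s <= h ->
    is_derive s 1 g ('D_(delta_mx ord0 i) u (z + s *: delta_mx ord0 i)).
  by move=> /hB[du _]; apply: is_derive_line; exact: diff_derivable.
have dg' s : s \in `]0, h[ ->
    is_derive s 1 g ('D_(delta_mx ord0 i) u (z + s *: delta_mx ord0 i)).
  by rewrite in_itv/= => /andP[s0 sh]; apply: dg; rewrite !ltW.
have cg : {within `[0, h], continuous g}.
  apply: derivable_within_continuous => s; rewrite in_itv/= => sh.
  by have [] := dg s sh.
have [] := MVT_segment h0 dg' cg.
move=> c; rewrite in_itv/= => /hB[_ gB].
rewrite {1 2}/g scale0r addr0 subr0 => ->.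
rewrite normrM (ger0_norm h0) mulrC ler_wpM2l//; apply: le_trans gB.
by have := coord_le_norm2 (gradient u (z + c *: delta_mx ord0 i)) i; rewrite mxE.
Qed.

End increments.

Section gradient_levels.
Context {R : realType} {n : nat}.
Variables (Omega : set 'rV[R]_n) (u : 'rV[R]_n -> R) (t : R).
Variables (J : set nat) (lev : nat -> nat) (P : nat -> int * 'rV[int]_n).
Hypothesis openO : open Omega.
Hypothesis C1u : C1 Omega u.
Hypothesis t_gt0 : 0 < t.
Hypothesis cover : forall i z, Omega z -> 2 ^+ i * t < norm2 (gradient u z) ->
  exists b, \forall z' \near z,
    exists2 a, (a < b)%N & [/\ J a, lev a = i & cube (P a) z'].

(** At step N the grid has mesh 2^-N. Only the first N cubes of the covers are
    used, and only those that are unions of grid cells, so that the points in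
    them can be counted exactly; every cube is eventually active. *)
Definition active N a : bool := `[< J a >] && (- N%:Z <= (P a).1).

Definition level_sum N (z : 'rV[R]_n) : R :=
  \sum_(a < N | active N a) 2 ^+ lev a * (`[< cube (P a) z >])%:R.

(** A step function that dominates f near each point once N is large: 2 t where
    f <= t, and 4 t 2^i where 2^i t < f <= 2^(i+1) t. The slack factor 2 leaves
    room for the variation of f near the point. *)
Definition local_bound N z : R := t * (2 + 4 * level_sum N z).

Lemma level_sum_ge0 N z : 0 <= level_sum N z.
Proof. by apply: sumr_ge0 => a _; rewrite mulr_ge0// exprn_ge0. Qed.

Lemma local_bound_ge0 N z : 0 <= local_bound N z.
Proof. by rewrite mulr_ge0 ?(ltW t_gt0)// addr_ge0// mulr_ge0// level_sum_ge0. Qed.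

Lemma near_dyadic_lt (e : R) : 0 < e -> \forall N \near \oo, dyadic (- N%:Z) < e.
Proof.
move=> e0; near=> N.
have N0 : e^-1 < N%:R :> R by near: N; exact: nbhs_infty_gtr.
rewrite /dyadic -invr_expz -exprnP -[e]invrK ltf_pV2 ?posrE ?exprn_gt0 ?invr_gt0//.
apply: lt_trans N0 _; rewrite -natrX ltr_nat; exact: ltn_expl.
Unshelve. all: by end_near. Qed.

Lemma gradient_lt_local_bound z : Omega z ->
  exists2 B, norm2 (gradient u z) < B &
    exists N0, \forall z' \near z, forall N, (N0 <= N)%N -> B <= local_bound N z'.
Proof.
move=> Oz; have [small|big] := lerP (norm2 (gradient u z)) t.
  exists (2 * t); first by apply: le_lt_trans small _; rewrite ltr_pMl// ltr1n.
  exists 0%N; near=> z' => N _.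
  by rewrite mulrC ler_pM2l// lerDl mulr_ge0// level_sum_ge0.
have [i [ilo ihi]] : exists i, 2 ^+ i * t < norm2 (gradient u z) /\
    norm2 (gradient u z) <= 2 ^+ i.+1 * t.
  have ex : exists j, norm2 (gradient u z) <= 2 ^+ j * t.
    exists (Num.bound (norm2 (gradient u z) / t)).
    rewrite -ler_pdivrMr//; set r := _ / t.
    have r0 : 0 <= r by rewrite divr_ge0 ?norm2_ge0// ltW.
    apply/ltW/(lt_trans (archi_boundP r0)).
    by rewrite -natrX ltr_nat ltn_expl.
  case: (ex_minnP ex) => -[|i] hi imin.
    by move: big; rewrite ltNge; move: hi; rewrite expr0 mul1r => ->.
  exists i; split => //; rewrite ltNge; apply/negP => /imin.
  by rewrite ltnn.
have [b hb] := cover Oz ilo.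
exists (2 ^+ i.+2 * t).
  apply: le_lt_trans ihi _; rewrite ltr_pM2r//.
  by rewrite ltr_eXn2l// ltr1n.
(* A crude bound that makes the first b cubes active for N >= b + c. *)
pose c := (\sum_(a < b) absz (P a).1)%N.
exists (b + c)%N; near=> z' => N bcN.
have [a ab [Ja la Paz]] : exists2 a, (a < b)%N & [/\ J a, lev a = i & cube (P a) z'].
  by near: z'.
have aN : (a < N)%N by lia.
have act : active N a.
  apply/andP; split; first exact/asboolP.
  have : (absz (P a).1 <= c)%N by rewrite /c (bigD1 (Ordinal ab))//= leq_addr.
  by lia.
rewrite mulrC ler_pM2l// /level_sum (bigD1 (Ordinal aN))//=.
rewrite asboolT// mulr1 la !exprS.
set S := \sum_(_ < _ | _) _.
have S0 : 0 <= S by apply: sumr_ge0 => k _; rewrite mulr_ge0// exprn_ge0.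
have : 0 <= 2 ^+ i :> R by rewrite exprn_ge0.
lra.
Unshelve. all: by end_near. Qed.

(** The local bound of the previous lemma controls u by the mean value theorem;
    compactness makes N uniform on K. *)
Lemma near_increment_le (K : set 'rV[R]_n) : compact K -> K `<=` Omega ->
  \forall N \near \oo, forall z i, K z ->
    `|u (z + dyadic (- N%:Z) *: delta_mx ord0 i) - u z|
      <= dyadic (- N%:Z) * local_bound N z.
Proof.
move=> /compact_near_coveringP cK KO.
have H : \forall N \near \oo, K `<=` (fun z => forall i,
    `|u (z + dyadic (- N%:Z) *: delta_mx ord0 i) - u z|
      <= dyadic (- N%:Z) * local_bound N z).
  apply: cK => z /KO Oz.
  have [B zB [N0 hB]] := gradient_lt_local_bound Oz.
  have : \forall z' \near z, Omega z' /\ norm2 (gradient u z') < B.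
    have c : {for z, continuous (@norm2 R n \o gradient u)}.
      by apply: continuous_comp (C1u Oz).2 _; exact: continuous_norm2.
    near=> z'; split; near: z'; first exact: open_nbhs_nbhs (conj openO Oz).
    exact: cvgr_lt _ c _ zB.
  move=> /nbhs_ballP[e /= e0 he].
  have e20 : 0 < e / 2 by rewrite divr_gt0.
  near=> z' N => i.
  apply: le_trans (increment_le (B := B) _ _) _; first exact: dyadic_ge0.
    move=> s /andP[s0 sN].
    suff /he[Oz' /ltW ?] : ball z e (z' + s *: delta_mx ord0 i).
      by split => //; exact: (C1u Oz').1.
    rewrite -ball_normE/= opprD addrA.
    have d1 : `|z - z'| < e / 2 by near: z'; exact: cvgr_dist_lt.
    have d2 : `|s *: (delta_mx ord0 i : 'rV[R]_n)| <= s.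
      apply: norm_le_coord => // j; rewrite !mxE normrM ger0_norm//.
      by case: (_ && _); rewrite ?normr1 ?normr0 ?mulr1 ?mulr0.
    have d3 : dyadic (- N%:Z) < e / 2 by near: N; exact: near_dyadic_lt.
    have := ler_normB (z - z') (s *: delta_mx ord0 i); lra.
  rewrite ler_wpM2l ?dyadic_ge0//.
  have zN : forall N, (N0 <= N)%N -> B <= local_bound N z' by near: z'.
  have NN : (N0 <= N)%N by near: N; exact: nbhs_infty_ge.
  exact: zN.
by apply: filterS H => N KN z i /KN.
Unshelve. all: by end_near. Qed.

End gradient_levels.

(** * Averages over cubes that lie in no heavy cube *)

Section grid.
Context {R : realType} {n : nat}.
Implicit Types (z k : 'rV[int]_n) (N r : nat).

Definition grid_point N z : 'rV[R]_n :=
  \row_i ((z ord0 i)%:~R * dyadic (- N%:Z)).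

Lemma grid_point_step N z i :
  grid_point N (z + unit_step i)
    = grid_point N z + dyadic (- N%:Z) *: delta_mx ord0 i.
Proof.
apply/rowP => j; rewrite !mxE intrD mulrDl; congr (_ + _).
by rewrite eqxx mulrC; case: eqP.
Qed.

Lemma dyadic_shift N r : dyadic (r%:Z - N%:Z) = (2 ^ r)%:R * dyadic (- N%:Z) :> R.
Proof. by rewrite dyadicD dyadic_nat. Qed.

Lemma cube_grid_point N r k z :
  cube (r%:Z - N%:Z, k) (grid_point N z) <-> in_block (2 ^ r) k z.
Proof.
have N0 := dyadic_gt0 (R := R) (- N%:Z).
rewrite cubeP; split.
  move=> h; apply/forallP => i; move: (h i); rewrite mxE /side/= dyadic_shift.
  rewrite !mulrA ler_pM2r// ltr_pM2r//.
  rewrite (_ : (2 ^ r)%:R = ((2 ^ r)%N%:Z)%:~R :> R)//.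
  by rewrite -!intrM ler_int ltr_int.
move=> /forallP h i; move: (h i); rewrite mxE /side/= dyadic_shift.
rewrite !mulrA ler_pM2r// ltr_pM2r//.
rewrite (_ : (2 ^ r)%:R = ((2 ^ r)%N%:Z)%:~R :> R)//.
by rewrite -!intrM ler_int ltr_int.
Qed.

Lemma block_point_in_block M k (v : {ffun 'I_n -> 'I_M}) :
  in_block M k (block_point k v).
Proof.
apply/forallP => i; rewrite mxE; have := ltn_ord (v i).
by move: (nat_of_ord (v i)) => a; lia.
Qed.

Lemma block_point_cube N r k (v : {ffun 'I_n -> 'I_(2 ^ r)}) :
  cube (r%:Z - N%:Z, k) (grid_point N (block_point k v)).
Proof. by apply/cube_grid_point; exact: block_point_in_block. Qed.

Lemma side_neq0 (Q : int * 'rV[int]_n) : side Q != 0 :> R.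
Proof. exact: dyadic_neq0. Qed.

End grid.

Section light_cubes.
Context {R : realType} {n : nat} (delta : R).
Hypothesis n_gt0 : (0 < n)%N.
Hypothesis delta_gt0 : 0 < delta.
Hypothesis delta_le : delta <= n%:R.
Variables (J : set nat) (lev : nat -> nat) (P : nat -> int * 'rV[int]_n).

Definition level_weight a : R :=
  (2 ^+ lev a) `^ (delta / n%:R) * (side (P a)) `^ delta.

Lemma level_weight_ge0 a : 0 <= level_weight a.
Proof. by rewrite mulr_ge0// powR_ge0. Qed.

Let q := delta / n%:R.
Let n0 : 0 < n%:R :> R. Proof. by rewrite ltr0n. Qed.
Let q_gt0 : 0 < q. Proof. exact: divr_gt0. Qed.
Let q_le1 : q <= 1. Proof. by rewrite ler_pdivrMr// mul1r. Qed.

(** The cubes above Q are included so that no cube of the covers, which would be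
    heavy itself, can contain Q. *)
Definition light Q : Prop :=
  forall Q', subcube (R := R) Q Q' -> ~ heavy delta J P level_weight Q'.

(** A cube of the covers is itself heavy, its own weight being at least
    l^delta. *)
Lemma light_not_subcube Q a : J a -> light Q -> ~ subcube (R := R) Q (P a).
Proof.
move=> Ja lQ QP; apply: (lQ _ QP); rewrite /heavy.
apply: (@le_trans _ _ (level_weight a)%:E).
  rewrite lee_fin ler_peMl ?powR_ge0//.
  apply: (@le_trans _ _ (1 `^ q)); first by rewrite powR1.
  rewrite ge0_ler_powR ?nnegrE ?(ltW q_gt0) ?exprn_ge0//.
  by rewrite exprn_ege1// ler1n.
rewrite -(esum_set1 (a := fun a => (level_weight a)%:E)) ?lee_fin ?level_weight_ge0//.
apply: subset_esum => [b ->|b]; last by rewrite lee_fin level_weight_ge0.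
by split => //=; exact: subcube_refl.
Qed.

(** The covers occupy little of a light cube Q. The relative masses rho_a of the
    cubes that meet Q satisfy rho_a^q = weight / l(Q)^delta, so their sum is
    less than 1 as Q is not heavy; and rho_a <= rho_a^q because rho_a < 1 and
    q <= 1. *)
Lemma light_level_sum N r (k : 'rV[int]_n) : light (r%:Z - N%:Z, k) ->
  block_sum (2 ^ r) k (fun z => level_sum J lev P N (grid_point N z))
    <= ((2 ^ r) ^ n)%:R :> R.
Proof.
move=> lQ; set Q := (_, k) in lQ.
pose V : R := ((2 ^ r) ^ n)%:R.
have V0 : 0 < V by rewrite ltr0n !expn_gt0.
pose cnt a := block_sum (2 ^ r) k
  (fun z => (`[< cube (P a) (grid_point N z : 'rV[R]_n) >])%:R : R).
have -> : block_sum (2 ^ r) k (fun z => level_sum J lev P N (grid_point N z)) =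
    \sum_(a < N | active J P N a) 2 ^+ lev a * cnt a.
  rewrite /block_sum /level_sum exchange_big/=; apply: eq_bigr => a _.
  by rewrite mulr_sumr.
have sQ0 : 0 < side Q :> R := dyadic_gt0 _.
have VE : V = (side Q / dyadic (- N%:Z)) ^+ n.
  by rewrite /side/= dyadic_shift mulfK ?dyadic_neq0// /V natrX.
pose meets a := active J P N a && (cnt a != 0).
pose rho a : R := 2 ^+ lev a * (side (P a) / side Q) ^+ n.
have rho0 a : 0 <= rho a.
  by rewrite mulr_ge0// exprn_ge0// divr_ge0// dyadic_ge0.
have rhoq a : rho a `^ q = level_weight a / side Q `^ delta.
  rewrite powRM ?exprn_ge0 ?divr_ge0 ?dyadic_ge0// /level_weight -mulrA.
  congr (_ * _); rewrite -powR_mulrn ?divr_ge0 ?dyadic_ge0// -powRrM.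
  rewrite (_ : n%:R * q = delta); last by rewrite /q mulrCA divff ?mulr1// gt_eqF.
  rewrite powRM ?invr_ge0 ?dyadic_ge0// -powR_inv1 ?dyadic_ge0// -powRrM.
  by rewrite mulN1r powRN.
have sub a : meets a -> subcube (R := R) (P a) Q /\ 2 ^+ lev a * cnt a <= V * rho a.
  move=> /andP[/andP[/asboolP Ja aN] c0].
  have [v vP] : exists v : {ffun 'I_n -> 'I_(2 ^ r)},
      cube (P a) (grid_point N (block_point k v) : 'rV[R]_n).
    apply/not_existsP => h; move/eqP: c0; apply; rewrite /cnt /block_sum.
    by rewrite big1// => v _; rewrite asboolF.
  have vQ : cube Q (grid_point N (block_point k v) : 'rV[R]_n).
    exact: block_point_cube.
  have PQ : subcube (R := R) (P a) Q.
    suff PQ1 : (P a).1 <= Q.1 by exact: subcube_meet PQ1 vP vQ.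
    have := le_total Q.1 (P a).1 => /orP[QP|//].
    by exfalso; apply: (light_not_subcube Ja lQ); exact: subcube_meet QP vQ vP.
  split=> //; rewrite /rho mulrCA ler_wpM2l ?exprn_ge0//.
  rewrite VE -exprMn mulrC mulrA divfK ?side_neq0//.
  have [r' r'E] : exists r' : nat, (P a).1 = r'%:Z - N%:Z.
    by exists (absz ((P a).1 + N%:Z)); lia.
  rewrite /side r'E dyadic_shift mulfK ?dyadic_neq0// -natrX.
  case e : (2 ^ r')%N => [|M]; first by have := expn_gt0 2 r'; rewrite e.
  apply: le_trans (block_sum_in_block _ k M (P a).2); rewrite /cnt.
  apply: ler_sum => v' _; rewrite ler_nat -e.
  case: asboolP => // h.
  have := (@cube_grid_point R n N r' (P a).2 (block_point k v')).1.
  by rewrite -r'E -surjective_pairing => /(_ h) ->.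
have heavyQ : (\sum_(a < N | meets a) level_weight a < side Q `^ delta).
  have /negP := lQ Q (subcube_refl Q); rewrite -ltNge -lte_fin.
  apply: le_lt_trans; rewrite -sumEFin -(big_mkord meets (fun a => (level_weight a)%:E)).
  rewrite -big_filter; apply: esum_ge_seq.
  - by move=> a; rewrite lee_fin level_weight_ge0.
  - by rewrite filter_uniq// iota_uniq.
  - move=> a; rewrite mem_filter => /andP[ma _].
    by split; [have /andP[/andP[/asboolP]] := ma|exact: (sub a ma).1].
have sum1 : \sum_(a < N | meets a) rho a `^ q < 1.
  under eq_bigr do rewrite rhoq.
  by rewrite -mulr_suml ltr_pdivrMr ?mul1r// powR_gt0.
have rho_le a : (a < N)%N -> meets a -> rho a <= rho a `^ q.
  move=> aN ma.
  have lt1 : rho a `^ q < 1.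
    apply: le_lt_trans sum1; rewrite (bigD1 (Ordinal aN))//= lerDl.
    by apply: sumr_ge0 => ? _; exact: powR_ge0.
  have [->|rn0] := eqVneq (rho a) 0; first exact: powR_ge0.
  apply: ger1_powR => //; rewrite lt0r rn0 rho0/= leNgt; apply/negP => r1.
  have := @gt0_ltr_powR R q q_gt0 1 (rho a); rewrite !nnegrE ler01 rho0 powR1.
  by move=> /(_ isT isT r1); rewrite ltNge (ltW lt1).
rewrite -/V (bigID (fun a : 'I_N => cnt a != 0))/= addrC big1 ?add0r; last first.
  by move=> a /andP[_ /negPn/eqP->]; rewrite mulr0.
apply: (@le_trans _ _ (\sum_(a < N | meets a) V * rho a `^ q)).
  apply: ler_sum => a ma; apply: le_trans (sub a ma).2 _.
  by rewrite ler_wpM2l ?(ltW V0)// rho_le.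
by rewrite -mulr_sumr ler_piMr ?(ltW V0)// ltW.
Qed.

End light_cubes.

(** * Comparison of averages over neighbouring cubes *)

Section box.
Context {R : realType} {n : nat}.
Implicit Types (y z : 'rV[R]_n).

Lemma compact_box y (r : R) : 0 <= r -> compact [set z | `|z - y| <= r].
Proof.
move=> r0; rewrite (_ : [set _ | _] =
    [set z : 'rV[R]_n | forall i, `[y ord0 i - r, y ord0 i + r]%classic (z ord0 i)]).
  exact: (@rV_compact R n _ (fun i => @segment_compact R _ _)).
apply/seteqP; split => z /= h.
  move=> i; rewrite in_itv/= -ler_distl; apply: le_trans h.
  by have := coord_le_norm (z - y) i; rewrite !mxE.
apply: norm_le_coord => // i; rewrite !mxE ler_distl.
by have := h i; rewrite in_itv.
Qed.

Lemma adjacent_cube_dist m y k z : adjacent_index (cube_index m y) k ->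
  cube (m, k) z -> `|z - y| <= 2 * dyadic m.
Proof.
move=> adj kz; have s0 := dyadic_gt0 (R := R) m.
apply: norm_le_coord => [|i]; first by rewrite mulr_ge0// ltW.
have := (cubeP _ _).1 kz i; have := (cubeP _ _).1 (cube_ofP m y) i.
rewrite !mxE /side/= -/(dyadic m); have := adj i; rewrite !mxE.
set a := Num.floor _; move: (k ord0 i) => b ab.
rewrite !intrD !mulrDl !mul1r => /andP[h1 h2] /andP[h3 h4].
have := ab; rewrite ler_norml => /andP[h5 h6].
have {}h5 : a%:~R - 1 <= b%:~R :> R by rewrite -[1]/(1%:~R) -intrB ler_int; lia.
have {}h6 : b%:~R <= a%:~R + 1 :> R by rewrite -[1]/(1%:~R) -intrD ler_int; lia.
have {}h5 : (a%:~R - 1) * dyadic m <= b%:~R * dyadic m :> R by rewrite ler_pM2r.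
have {}h6 : b%:~R * dyadic m <= (a%:~R + 1) * dyadic m :> R by rewrite ler_pM2r.
rewrite mulrDl mul1r in h6; rewrite mulrBl mul1r in h5.
rewrite ler_norml; apply/andP; split; lra.
Qed.

Lemma cube_index_adjacent m y z : `|z - y| <= dyadic m ->
  adjacent_index (cube_index m y) (cube_index m z).
Proof.
move=> zy i; rewrite !mxE.
have s0 := dyadic_gt0 (R := R) m.
have : `|z ord0 i / dyadic m - y ord0 i / dyadic m| <= 1.
  rewrite -mulrBl normrM [X in _ * X]gtr0_norm ?invr_gt0// ler_pdivrMr// mul1r.
  by apply: le_trans zy; have := coord_le_norm (z - y) i; rewrite !mxE.
rewrite ler_distl; set a := z _ _ / _; set b := y _ _ / _ => /andP[ab ba].
have := eqxx (Num.floor a); rewrite floor_eq => /andP[].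
have := eqxx (Num.floor b); rewrite floor_eq => /andP[].
move: (Num.floor a) (Num.floor b) => k l lb bl ka ak.
have h1 : (k < l + 2).
  by rewrite -(ltr_int R) intrD; move: bl; rewrite !intrD => bl; lra.
have h2 : (l < k + 2).
  by rewrite -(ltr_int R) intrD; move: ak; rewrite !intrD => ak; lra.
by rewrite ler_norml; apply/andP; split; lia.
Qed.

Lemma cube_index_parent m y : exists c : {ffun 'I_n -> 'I_2},
  cube_index m y = child_index (cube_index (m + 1) y) c.
Proof.
have /fin_all_exists[c hc] i : exists c : 'I_2, cube_index m y ord0 i =
    cube_index (m + 1) y ord0 i * 2 + c%:Z.
  rewrite !mxE dyadicS; set a := y _ _ / dyadic m.
  rewrite (_ : y ord0 i / (2 * dyadic m) = a / 2); last first.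
    by rewrite /a; field; rewrite dyadic_neq0.
  have := eqxx (Num.floor a); rewrite floor_eq => /andP[].
  have := eqxx (Num.floor (a / 2)); rewrite floor_eq => /andP[].
  move: (Num.floor a) (Num.floor (a / 2)) => k l lb bl ka ak.
  have h1 : (k < l * 2 + 2).
    by rewrite -(ltr_int R) intrD intrM; move: bl; rewrite !intrD => bl; lra.
  have h2 : (l * 2 < k + 1).
    by rewrite -(ltr_int R) intrM; lra.
  have h3 : (absz (k - l * 2)%R < 2)%N by lia.
  by exists (Ordinal h3) => /=; lia.
exists (finfun c); apply/rowP => i; rewrite hc [in RHS]mxE ffunE.
by congr (_ * _ + _).
Qed.

End box.

Section grid_means.
Context {R : realType} {n : nat} (delta : R).
Hypothesis n_gt0 : (0 < n)%N.
Hypothesis delta_gt0 : 0 < delta.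
Hypothesis delta_le : delta <= n%:R.
Variables (Omega : set 'rV[R]_n) (u : 'rV[R]_n -> R) (t : R).
Variables (J : set nat) (lev : nat -> nat) (P : nat -> int * 'rV[int]_n).
Hypothesis openO : open Omega.
Hypothesis C1u : C1 Omega u.
Hypothesis t_gt0 : 0 < t.
Hypothesis cover : forall i z, Omega z -> 2 ^+ i * t < norm2 (gradient u z) ->
  exists b, \forall z' \near z,
    exists2 a, (a < b)%N & [/\ J a, lev a = i & cube (P a) z'].

Definition grid_mean (N : nat) (m : int) (k : 'rV[int]_n) : R :=
  block_sum (2 ^ absz (N%:Z + m)) k (fun z => u (grid_point N z))
    / ((2 ^ absz (N%:Z + m)) ^ n)%:R.

(** On the cubes around y the increments of u are dominated by the local bound,
    whose average over a light cube is at most 6 t. The discrete Poincare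
    inequality then gives n 2^m times twice that bound. *)
Lemma grid_mean_step (m : int) (y : 'rV[R]_n) :
  (forall z, `|z - y| <= 2 * dyadic m -> Omega z) ->
  (forall k, adjacent_index (cube_index m y) k -> light delta J lev P (m, k)) ->
  \forall N \near \oo,
    (forall k, adjacent_index (cube_index m y) k ->
      `|grid_mean N m k - grid_mean N m (cube_index m y)|
        <= 12 * n%:R * t * dyadic m) /\
    `|grid_mean N (m + 1) (cube_index (m + 1) y)
        - grid_mean N m (cube_index m y)| <= 12 * n%:R * t * dyadic m.
Proof.
move=> yO yl.
have d20 : 0 <= 2 * dyadic m :> R by rewrite mulr_ge0// dyadic_ge0.
have incr :=
  near_increment_le openO C1u t_gt0 cover (compact_box (y := y) d20) yO.
near=> N.
have mN : (absz m <= N)%N by near: N; exact: nbhs_infty_ge.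
have incrN : forall z i, `|z - y| <= 2 * dyadic m ->
    `|u (z + dyadic (- N%:Z) *: delta_mx ord0 i) - u z|
      <= dyadic (- N%:Z) * local_bound t J lev P N z.
  by near: N; exact: incr.
set K := cube_index m y.
pose r := absz (N%:Z + m); have rE : m = r%:Z - N%:Z by rewrite /r; lia.
have r1E : absz (N%:Z + (m + 1)) = r.+1 by rewrite /r; lia.
rewrite /grid_mean r1E -/r.
set V : R := ((2 ^ r) ^ n)%:R.
have V0 : 0 < V by rewrite ltr0n !expn_gt0.
pose w z := u (grid_point N z).
pose g z := dyadic (- N%:Z) * local_bound t J lev P N (grid_point N z).
have g0 z : 0 <= g z by rewrite mulr_ge0 ?dyadic_ge0// local_bound_ge0.
pose G := dyadic (- N%:Z) * (6 * t) * V.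
case e : (2 ^ r)%N => [|M]; first by have := expn_gt0 2 r; rewrite e.
have hG k : adjacent_index K k -> increments_le M.+1 k w g /\ block_sum M.+1 k g <= G.
  move=> Kk; rewrite -e; split.
    move=> i v; rewrite /w grid_point_step; apply: incrN.
    apply: (adjacent_cube_dist Kk); rewrite {1}rE; exact: block_point_cube.
  have := yl k Kk; rewrite rE => lk.
  have := light_level_sum n_gt0 delta_gt0 delta_le lk; rewrite -/V => lsum.
  have -> : block_sum (2 ^ r) k g = dyadic (- N%:Z) * t * (2 * V +
      4 * block_sum (2 ^ r) k (fun z => level_sum J lev P N (grid_point N z))).
    rewrite /block_sum /g /local_bound -!mulr_sumr -mulrA big_split/= -mulr_sumr.
    by rewrite sumr_const card_ffun !card_ord -[2 *+ (_ ^ n)]mulr_natr.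
  rewrite /G; set x := block_sum _ _ _ in lsum *.
  rewrite -!mulrA ler_pM2l ?dyadic_gt0// (mulrCA 6) ler_pM2l//; lra.
have GE : n%:R * (M.+1%:R * (2 * G)) = 12 * n%:R * t * dyadic m * V.
  by rewrite rE dyadic_shift e /G; ring.
split=> [k Kk|].
  rewrite -mulrBl normrM [X in _ * X]gtr0_norm ?invr_gt0// ler_pdivrMr// -GE.
  exact: block_sum_adjacent g0 hG Kk.
have [c Kc] := cube_index_parent m y.
have VS : ((2 ^ r.+1) ^ n)%:R = (2 ^ n)%:R * V by rewrite expnS expnMn natrM.
have p0 : 0 < (2 ^ n)%:R :> R by rewrite ltr0n expn_gt0.
have := @block_sum_parent R n M (cube_index (m + 1) y) c w g G g0.
rewrite -Kc => /(_ hG); rewrite GE VS expnS e => h.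
set A := block_sum (2 * M.+1) _ _ in h *; set B := block_sum M.+1 _ _ in h *.
have -> : A / ((2 ^ n)%:R * V) - B / V = (A - (2 ^ n)%:R * B) / ((2 ^ n)%:R * V).
  by field; rewrite !gt_eqF.
rewrite normrM [X in _ * X]gtr0_norm ?invr_gt0 ?mulr_gt0//.
rewrite ler_pdivrMr ?mulr_gt0//; apply: le_trans h _.
by rewrite le_eqVlt; apply/orP; left; apply/eqP; ring.
Unshelve. all: by end_near. Qed.

End grid_means.

(** * Geometry of John domains *)

Section john_geometry.
Context {R : realType} {n : nat}.
Implicit Types (x y z v : 'rV[R]_n).

Lemma norm2Z (c : R) v : norm2 (c *: v) = `|c| * norm2 v.
Proof.
rewrite /norm2 -sqrtr_sqr -sqrtrM ?sqr_ge0//; congr Num.sqrt.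
by rewrite mulr_sumr; apply: eq_bigr => i _; rewrite mxE exprMn.
Qed.

Lemma norm2_0 : norm2 (0 : 'rV[R]_n) = 0.
Proof. by rewrite -(scale0r (0 : 'rV[R]_n)) norm2Z normr0 mul0r. Qed.

Lemma norm2_distrC v w : norm2 (v - w) = norm2 (w - v :> 'rV[R]_n).
Proof. by rewrite -opprB -scaleN1r norm2Z normrN1 mul1r. Qed.

(** Appending t to a partition of [0, s] gives a partition of [0, t] whose
    polygon is longer by |g t - g s|. *)
Lemma arclength_lipschitz (l : R) (g : R -> 'rV[R]_n) s t :
  arclength_curve l g -> 0 <= s -> s <= t -> t <= l ->
  norm2 (g t - g s) <= t - s.
Proof.
move=> [_ _ gl] s0 st tl.
have [<-|sNt] := eqVneq s t; first by rewrite !subrr norm2_0.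
have slt : s < t by rewrite lt_neqAle sNt.
set d := norm2 _; rewrite lerBrDl -lerBrDr -lee_fin.
have <- : curve_length 0 s g = s%:E by rewrite gl// s0 (le_trans st).
apply: ge_ereal_sup => _ [p ps <-]; rewrite lee_fin lerBrDr -lee_fin.
have <- : curve_length 0 t g = t%:E by rewrite gl// tl (le_trans s0).
apply: ereal_sup_ubound; exists (p ++ [:: t]).
  by apply: itv_partition_cat ps _; exact: itv_partition1.
rewrite size_cat/= addn1 big_nat_recr//=; congr EFin; congr (_ + _).
  apply: eq_big_nat => i /andP[_ ip].
  have nE j : (j < (size p).+1)%N -> nth t (0 :: p ++ [:: t]) j = nth s (0 :: p) j.
    by move=> jp; rewrite -cat_cons nth_cat/= jp; exact: set_nth_default.
  rewrite nE ?(leq_trans ip)//.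
  by rewrite -[nth t (p ++ _) i]/(nth t (0 :: p ++ [:: t]) i.+1) nE.
rewrite /d; have /eqP lp := ps.2.
congr (norm2 (g _ - g _)).
  by rewrite nth_cat ltnn subnn.
rewrite -cat_cons nth_cat/= ltnSn -[X in nth _ _ X]/((size (0 :: p)).-1).
by rewrite nth_last/= lp.
Qed.

(** The segment from y to a point of the ball avoids the boundary, so its part
    in Omega is open and closed in it. *)
Lemma ball2_sub_domain (Omega : set 'rV[R]_n) y (r : R) : open Omega ->
  Omega y -> (r%:E <= dist2 y (boundary Omega))%E -> ball2 y r `<=` Omega.
Proof.
move=> oO Oy rd z zr.
pose h (s : R) := y + s *: (z - y).
have hc : continuous h.
  move=> s; apply: (@cvgD R 'rV[R]_n _ (nbhs s) _ (cst y)); first exact: cvg_cst.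
  by apply: (@cvgZr_tmp R 'rV[R]_n); exact: cvg_id.
pose S := h @` `[0, 1]%classic.
have cS : connected S.
  apply: connected_continuous_connected; last exact: continuous_subspaceT.
  by apply/connected_intervalP; exact: interval_is_interval.
have Sb p : S p -> closure Omega p -> Omega p.
  move=> [s /= s01 <-] cO; apply: contrapT => nO.
  have : (dist2 y (boundary Omega) <= (norm2 (y - h s))%:E)%E.
    apply: ereal_inf_lbound; exists (h s) => //; split=> // /interior_subset.
    by [].
  rewrite leNgt => /negP; apply; apply: lt_le_trans rd; rewrite lte_fin.
  rewrite norm2_distrC /h addrAC subrr add0r norm2Z.
  move: s01; rewrite in_itv/= => /andP[s0 s1]; rewrite ger0_norm//.
  by apply: le_lt_trans zr; rewrite ler_piMl ?norm2_ge0.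
have SO : S `&` Omega = S.
  apply: cS.
  - exists y; split => //; exists 0; first by rewrite /= in_itv/= lexx ler01.
    by rewrite /h scale0r addr0.
  - by exists Omega.
  - exists (closure Omega); first exact: closed_closure.
    apply/seteqP; split => p [Sp Op]; split => //; first exact: subset_closure.
    exact: Sb.
have : (S `&` Omega) z.
  rewrite SO; exists 1; first by rewrite /= in_itv/= lexx ler01.
  by rewrite /h scale1r addrC subrK.
by case.
Qed.

End john_geometry.

(** * Chains of cubes along a curve *)

Lemma grid_scale (N : nat) (m : int) : (absz m <= N)%N ->
  m = (absz (N%:Z + m))%:Z - N%:Z.
Proof. by lia. Qed.

Lemma predz_scale (m : int) (k : nat) : m - k%:Z = m - k.+1%:Z + 1.
Proof. by lia. Qed.

Lemma predz_scale_le (m : int) (k : nat) : m - k.+1%:Z + 1 <= m.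
Proof. by lia. Qed.

Section chain.
Context {R : realType} {n : nat} (delta : R).
Hypothesis n_gt0 : (0 < n)%N.
Hypothesis delta_gt0 : 0 < delta.
Hypothesis delta_le : delta <= n%:R.
Variables (Omega : set 'rV[R]_n) (u : 'rV[R]_n -> R) (t : R).
Variables (J : set nat) (lev : nat -> nat) (P : nat -> int * 'rV[int]_n).
Hypothesis openO : open Omega.
Hypothesis C1u : C1 Omega u.
Hypothesis t_gt0 : 0 < t.
Hypothesis cover : forall i z, Omega z -> 2 ^+ i * t < norm2 (gradient u z) ->
  exists b, \forall z' \near z,
    exists2 a, (a < b)%N & [/\ J a, lev a = i & cube (P a) z'].
Variables (kappa : R) (x x0 : 'rV[R]_n) (m0 : int) (l : R) (g : R -> 'rV[R]_n).
Hypothesis kappa_ge1 : 1 <= kappa.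
Hypothesis l_ge0 : 0 <= l.
Hypothesis g_lip : forall s t, 0 <= s -> s <= t -> t <= l ->
  `|g t - g s| <= t - s.
Hypothesis g0x : g 0 = x.
Hypothesis glx0 : g l = x0.
Hypothesis g_ball : forall s, 0 <= s <= l -> ball2 (g s) (s / kappa) `<=` Omega.
Hypothesis x0_ball : ball2 x0 (4 * n%:R * dyadic m0) `<=` Omega.
Hypothesis l_le : l <= 16 * n%:R * kappa * dyadic m0.
Hypothesis Ox : Omega x.
Hypothesis no_heavy : forall Q, heavy delta J P (level_weight delta lev P) Q ->
  ~ (`|x - corner Q| <= 35 * n%:R * kappa * side Q).

Let n1 : 1 <= n%:R :> R. Proof. by rewrite ler1n. Qed.
Let n0 : 0 < n%:R :> R. Proof. by rewrite ltr0n. Qed.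
Let k0 : 0 < kappa. Proof. exact: lt_le_trans kappa_ge1. Qed.
Let D := 16 * n%:R * kappa.
Let D16 : 16 <= D.
Proof.
rewrite /D -mulrA ler_pMr//; apply: le_trans kappa_ge1 _.
by rewrite ler_peMl// ltW.
Qed.
(** The cubes of side 2^m are those that meet the curve between the times T m
    and T (m + 1). Up to constants, the distance to the boundary is then at
    least 2^m and the distance to x at most kappa 2^m. Once T m = l the curve
    has reached x0, and the chain only changes scale there. *)
Let T (m : int) : R := Num.min l (D * dyadic m).

Let T_ge0 m : 0 <= T m.
Proof.
rewrite le_min l_ge0/= mulr_ge0 ?dyadic_ge0//.
by apply: le_trans D16.
Qed.

Let T_le m : T m <= l. Proof. by rewrite ge_min lexx. Qed.

Let T_step m : T (m + 1) <= 2 * D * dyadic m.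
Proof.
rewrite ge_min; apply/orP; right.
by rewrite dyadicS (_ : D * _ = 2 * D * dyadic m)//; ring.
Qed.

Let T_mono m : T m <= T (m + 1).
Proof.
rewrite le_min T_le/= (le_trans (_ : T m <= D * dyadic m))//.
  by rewrite ge_min lexx orbT.
rewrite ler_pM2l; last by apply: lt_le_trans D16.
have := dyadic_gt0 (R := R) m; rewrite dyadicS; lra.
Qed.

Let dyadic_mono (a b : int) : a <= b -> dyadic a <= dyadic b :> R.
Proof. by move=> ab; rewrite ler_eXz2l// ltr1n. Qed.

(** Both conditions for comparing averages at the point g s and the scale m. If
    the curve has ended, the room around g s = x0 comes from the ball about x0;
    otherwise it comes from the John condition at the time s >= T m. A heavy
    cube above one near g s would be within 35 n kappa sides of x. *)
Lemma curve_box m s : m + 1 <= m0 -> T m <= s -> s <= T (m + 1) ->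
  (forall z, `|z - g s| <= 2 * dyadic m -> Omega z) /\
  (forall k, adjacent_index (cube_index m (g s)) k -> light delta J lev P (m, k)).
Proof.
move=> mm0 Ts sT; have d0 := dyadic_gt0 (R := R) m.
have s0 : 0 <= s by exact: le_trans (T_ge0 m) Ts.
have sl : s <= l by exact: le_trans sT (T_le _).
have n4 : 2 * (2 * dyadic m) * n%:R = 4 * n%:R * dyadic m :> R by ring.
have nd : 0 < 4 * n%:R * dyadic m :> R by rewrite !mulr_gt0//.
split.
  move=> z zs; have zn : norm2 (z - g s) < 4 * n%:R * dyadic m.
    apply: le_lt_trans (norm2_le _) _.
    apply: (@le_lt_trans _ _ (n%:R * (2 * dyadic m))).
      by rewrite ler_wpM2l.
    rewrite (_ : 4 * n%:R * dyadic m = 2 * (n%:R * (2 * dyadic m))); last by ring.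
    by rewrite ltr_pMl ?ltr1n// !mulr_gt0//.
  have [lT|Tl] := lerP l (D * dyadic m).
    have sE : s = l.
      by apply/eqP; rewrite eq_le sl/=; move: Ts; rewrite /T (min_idPl lT).
    apply: x0_ball; rewrite /ball2/= -glx0 -sE; apply: lt_le_trans zn _.
    have mm : m <= m0 by apply: le_trans mm0; rewrite lerDl.
    by rewrite ler_pM2l ?mulr_gt0//; exact: dyadic_mono.
  apply: (g_ball (s := s)); first by rewrite s0 sl.
  rewrite /ball2/=; apply: lt_le_trans zn _.
  rewrite ler_pdivlMr//; move: Ts; rewrite /T (min_idPr (ltW Tl)) => Ts.
  apply: le_trans Ts; rewrite /D.
  rewrite (_ : 16 * n%:R * kappa * dyadic m =
    4 * (4 * n%:R * dyadic m * kappa)); last by ring.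
  by rewrite ler_peMl ?ler1n// mulr_ge0// ltW.
move=> k adj Q' QQ' hQ'; apply: (no_heavy hQ').
have ms : dyadic m <= side Q' :> R by apply: dyadic_mono; exact: QQ'.1.
have h1 : `|x - g s| <= 2 * D * dyadic m.
  rewrite -g0x distrC; apply: le_trans (g_lip (lexx 0) s0 sl) _.
  by rewrite subr0; apply: le_trans sT _; exact: T_step.
have h2 := adjacent_cube_dist adj (corner_cube (m, k)).
have h3 := cube_dist QQ'.2 (corner_cube Q').
set c := corner (m, k) in h2 h3.
have h4 : `|x - corner Q'| <= `|x - g s| + `|c - g s| + `|c - corner Q'|.
  apply: le_trans (ler_distD c _ _) _; rewrite lerD2r.
  by apply: le_trans (ler_distD (g s) _ _) _; rewrite (distrC (g s)).
apply: le_trans h4 _.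
have h5 : 2 * D * dyadic m <= 2 * D * side Q'.
  by rewrite ler_wpM2l// mulr_ge0//; apply: le_trans D16.
apply: (@le_trans _ _ ((2 * D + 3) * side Q')); first lra.
rewrite ler_wpM2r ?dyadic_ge0// /D.
have : 1 <= n%:R * kappa by rewrite mulr_ege1.
lra.
Qed.

Let V N m (y : 'rV[R]_n) : R := grid_mean u N m (cube_index m y).
Let E := 12 * n%:R * t.
Let E0 : 0 <= E. Proof. by rewrite !mulr_ge0// ltW. Qed.

(** Moves backwards along the curve at the fixed scale m in steps of length at
    most 2^m; every step leads to an adjacent cube. *)
Lemma chain_walk m (j : nat) s : m + 1 <= m0 -> T m <= s -> s <= T (m + 1) ->
  s - T m <= j%:R * dyadic m ->
  \forall N \near \oo, `|V N m (g s) - V N m (g (T m))| <= j%:R * (E * dyadic m).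
Proof.
move=> mm0; elim: j s => [|j IH] s Ts sT sj.
  have -> : s = T m.
    by apply/eqP; rewrite eq_le Ts andbT -subr_le0; move: sj; rewrite mul0r.
  by near=> N; rewrite subrr normr0 mul0r.
pose s' := Num.max (T m) (s - dyadic m).
have d0 := dyadic_gt0 (R := R) m.
have s's : s' <= s by rewrite ge_max Ts/= lerBlDr lerDl ltW.
have Ts' : T m <= s' by rewrite le_max lexx.
have near1 := IH s' Ts' (le_trans s's sT).
have s'j : s' - T m <= j%:R * dyadic m.
  rewrite lerBlDr ge_max -{1}[T m]add0r lerD2r mulr_ge0 ?(ltW d0)//=.
  by move: sj; rewrite -natr1 mulrDl mul1r; lra.
have sl : s <= l by exact: le_trans sT (T_le _).
have gg : `|g s' - g s| <= dyadic m.
  rewrite distrC; apply: le_trans (g_lip (le_trans (T_ge0 m) Ts') s's sl) _.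
  have : s - dyadic m <= s' by rewrite le_max lexx orbT.
  lra.
have [bx lt] := curve_box mm0 Ts sT.
have near2 := grid_mean_step n_gt0 delta_gt0 delta_le openO C1u t_gt0 cover bx lt.
move: near1 => /(_ s'j) near1; near=> N.
have h1 : `|V N m (g s') - V N m (g (T m))| <= j%:R * (E * dyadic m) by near: N.
have h2 : (forall k, adjacent_index (cube_index m (g s)) k ->
      `|grid_mean u N m k - grid_mean u N m (cube_index m (g s))|
        <= 12 * n%:R * t * dyadic m).
  by near: N; apply: filterS near2 => N [].
have h3 := h2 _ (cube_index_adjacent gg).
apply: le_trans (ler_distD (V N m (g s')) _ _) _.
rewrite -natr1 mulrDl mul1r addrC lerD// distrC; exact: h3.
Unshelve. all: by end_near. Qed.

(** From side 2^(m+1) to side 2^m: one passage to a child cube at g (T (m + 1)),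
    then about D steps along the curve. *)
Lemma chain_scale m : m + 1 <= m0 ->
  \forall N \near \oo, `|V N (m + 1) (g (T (m + 1))) - V N m (g (T m))|
     <= 3 * D * (E * dyadic m).
Proof.
move=> mm0; have d0 := dyadic_gt0 (R := R) m.
have D0 : 0 <= D by apply: le_trans D16.
have [j /andP[Dj jD]] : exists j : nat, D <= j%:R <= D + 1.
  exists (absz (Num.ceil D)); rewrite natr_absz ger0_norm.
    by rewrite ceil_ge/=; have := ceilB1_lt D; rewrite intrB/=; lra.
  by rewrite ceil_ge0; move: D16; lra.
have jT : T (m + 1) - T m <= j%:R * dyadic m.
  apply: (@le_trans _ _ (D * dyadic m)); last first.
    by rewrite ler_wpM2r ?(ltW d0).
  rewrite {2}/T; have [lT|Tl] := lerP l (D * dyadic m).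
    by rewrite lerBlDr (le_trans (T_le _))// lerDr mulr_ge0// ltW.
  have := T_step m; lra.
have walk := chain_walk mm0 (T_mono m) (lexx _) jT.
have [bx lt] := curve_box mm0 (T_mono m) (lexx _).
have step := grid_mean_step n_gt0 delta_gt0 delta_le openO C1u t_gt0 cover bx lt.
near=> N.
have h1 : `|V N m (g (T (m + 1))) - V N m (g (T m))|
    <= j%:R * (E * dyadic m) by near: N.
have h2 : `|V N (m + 1) (g (T (m + 1))) - V N m (g (T (m + 1)))| <= E * dyadic m.
  by near: N; apply: filterS step => N [].
apply: le_trans (ler_distD (V N m (g (T (m + 1)))) _ _) _.
apply: (@le_trans _ _ ((j%:R + 1) * (E * dyadic m))).
  by rewrite mulrDl mul1r addrC lerD.
rewrite (ler_wpM2r (mulr_ge0 E0 (ltW d0)))//.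
move: (D16) jD; lra.
Unshelve. all: by end_near. Qed.

Lemma chain_sum (k : nat) : \forall N \near \oo,
  `|V N m0 x0 - V N (m0 - k%:Z) (g (T (m0 - k%:Z)))|
     <= 3 * D * E * (dyadic m0 - dyadic (m0 - k%:Z)).
Proof.
elim: k => [|k IH].
  near=> N; rewrite subr0 subrr mulr0 /T (min_idPl _) ?glx0 ?subrr ?normr0//.
set m := m0 - k.+1%:Z; have mE : m0 - k%:Z = m + 1 := predz_scale m0 k.
have mm0 : m + 1 <= m0 := predz_scale_le m0 k.
rewrite mE in IH; have step := chain_scale mm0.
near=> N.
have h1 : `|V N m0 x0 - V N (m + 1) (g (T (m + 1)))| <=
  3 * D * E * (dyadic m0 - dyadic (m + 1)) by near: N.
have h2 : `|V N (m + 1) (g (T (m + 1))) - V N m (g (T m))|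
     <= 3 * D * (E * dyadic m) by near: N.
apply: le_trans (ler_distD (V N (m + 1) (g (T (m + 1)))) _ _) _.
apply: le_trans (lerD h1 h2) _.
rewrite dyadicS le_eqVlt; apply/orP; left; apply/eqP; ring.
Unshelve. all: by end_near. Qed.

(** The cubes shrink to x and u is continuous there. *)
Lemma chain_end (e : R) : 0 < e -> exists k : nat, \forall N \near \oo,
  `|V N (m0 - k%:Z) (g (T (m0 - k%:Z))) - u x| <= e.
Proof.
move=> e0; have cu : {for x, continuous u}.
  exact: differentiable_continuous (C1u Ox).1.
have : \forall z \near x, `|u z - u x| < e.
  by near=> z; rewrite distrC; near: z; exact: cvgr_dist_lt.
move=> /nbhs_ballP[r /= r0 hr].
have D0 : 0 < D + 1 by move: D16; lra.
have [k hk] : exists k : nat, (D + 1) * dyadic (m0 - k%:Z) < r.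
  have p : 0 < r / ((D + 1) * dyadic m0) by rewrite divr_gt0// mulr_gt0// dyadic_gt0.
  have [k _ /(_ k (leqnn k)) /=] := near_dyadic_lt p.
  rewrite ltr_pdivlMr ?mulr_gt0 ?dyadic_gt0// => h.
  by exists k; rewrite dyadicD mulrA mulrC.
exists k; set m := m0 - k%:Z in hk *.
near=> N.
have mN : (absz m <= N)%N by near: N; exact: nbhs_infty_ge.
pose r' := absz (N%:Z + m); have rE : m = r'%:Z - N%:Z := grid_scale mN.
rewrite /V /grid_mean -/r'; set K := cube_index m _.
set W : R := ((2 ^ r') ^ n)%:R.
have W0 : 0 < W by rewrite ltr0n !expn_gt0.
have -> : block_sum (2 ^ r') K (fun z => u (grid_point N z)) / W - u x =
    (\sum_v (u (grid_point N (@block_point n (2 ^ r') K v)) - u x)) / W.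
  rewrite sumrB sumr_const card_ffun !card_ord -[u x *+ _]mulr_natr.
  by rewrite mulrBl mulfK ?gt_eqF.
rewrite normrM [X in _ * X]gtr0_norm ?invr_gt0// ler_pdivrMr//.
apply: le_trans (ler_norm_sum _ _ _) _.
rewrite (_ : e * W = \sum_(v : {ffun 'I_n -> 'I_(2 ^ r')}) e); last first.
  by rewrite sumr_const card_ffun !card_ord -[RHS]mulr_natr.
apply: ler_sum => v _; apply/ltW/hr; rewrite -ball_normE/= distrC.
have c1 := @block_point_cube R n N r' K v; rewrite -rE in c1.
have c2 : cube (m, K) (g (T m)) by exact: cube_ofP.
have h1 := cube_dist c1 c2.
have h2 : `|g (T m) - x| <= D * dyadic m.
  rewrite -g0x; apply: le_trans (g_lip (lexx 0) (T_ge0 m) (T_le m)) _.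
  by rewrite subr0 ge_min lexx orbT.
apply: le_lt_trans (ler_distD (g (T m)) _ _) _.
apply: le_lt_trans hk; apply: le_trans (lerD h1 h2) _.
by rewrite /side/= mulrDl mul1r addrC.
Unshelve. all: by end_near. Qed.

Lemma chain_estimate (e : R) : 0 < e -> \forall N \near \oo,
  `|grid_mean u N m0 (cube_index m0 x0) - u x|
    <= 576 * n%:R ^+ 2 * kappa * t * dyadic m0 + e.
Proof.
move=> e0; have [k near1] := chain_end e0; have near2 := chain_sum k.
near=> N.
have h1 : `|V N (m0 - k%:Z) (g (T (m0 - k%:Z))) - u x| <= e by near: N.
have h2 : `|V N m0 x0 - V N (m0 - k%:Z) (g (T (m0 - k%:Z)))|
     <= 3 * D * E * (dyadic m0 - dyadic (m0 - k%:Z)) by near: N.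
apply: le_trans (ler_distD (V N (m0 - k%:Z) (g (T (m0 - k%:Z)))) _ _) _.
apply: lerD h1; apply: le_trans h2 _.
have -> : 576 * n%:R ^+ 2 * kappa * t * dyadic m0 = 3 * D * E * dyadic m0.
  by rewrite /D /E; ring.
have D0 : 0 <= D by apply: le_trans D16.
have DE0 : 0 <= 3 * D * E by apply: mulr_ge0 => //; exact: mulr_ge0.
rewrite (ler_wpM2l DE0)//.
by rewrite gerBl dyadic_ge0.
Unshelve. all: by end_near. Qed.

End chain.

(** * Oscillation in a John domain *)

Section john_oscillation.
Context {R : realType} {n : nat}.
Hypothesis n_gt0 : (0 < n)%N.

(** The centre has room comparable to the length of every curve: if l1 is the
    length of an almost longest curve, the John condition at its end gives a
    ball of radius l1 alpha / beta about x0, while all curves are shorter than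
    2 l1. This fixes the scale m0 of the common cube at the centre. *)
Lemma john_base (Omega : set 'rV[R]_n) (alpha beta : R) :
  john_domain alpha beta Omega ->
  exists (x0 : 'rV[R]_n) (m0 : int),
  [/\ Omega x0, 4 * n%:R * (beta / alpha) * dyadic m0 <= beta,
      ball2 x0 (4 * n%:R * dyadic m0) `<=` Omega &
      forall x, Omega x -> exists (l : R) (g : R -> 'rV[R]_n),
      [/\ 0 <= l,
          forall s t, 0 <= s -> s <= t -> t <= l -> `|g t - g s| <= t - s,
          g 0 = x /\ g l = x0,
          forall s, 0 <= s <= l -> ball2 (g s) (s / (beta / alpha)) `<=` Omega &
          l <= 16 * n%:R * (beta / alpha) * dyadic m0]].
Proof.
move=> [[oO _] _ /andP[a0 ab] [x0 Ox0 Oc]].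
have b0 : 0 < beta by apply: lt_le_trans ab.
have n0 : 0 < n%:R :> R by rewrite ltr0n.
set kappa := beta / alpha; have k0 : 0 < kappa by rewrite divr_gt0.
pose S := [set l | exists (x : 'rV[R]_n) (g : R -> 'rV[R]_n),
  [/\ arclength_curve l g, (forall t, 0 <= t <= l -> Omega (g t)),
    g 0 = x /\ g l = x0, l <= beta
    & forall t, 0 <= t <= l ->
      ((alpha / beta * t)%:E <= dist2 (g t) (boundary Omega))%E]].
have S_lip (l : R) (g : R -> 'rV[R]_n) s t : arclength_curve l g ->
    0 <= s -> s <= t -> t <= l -> `|g t - g s| <= t - s :> R.
  move=> gl s0 st tl; apply: le_trans (norm_le_norm2 _) _.
  exact: arclength_lipschitz gl s0 st tl.
have supS : has_sup S.
  split; last by exists beta => l [x [g []]].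
  by have [l [g ?]] := Oc _ Ox0; exists l, x0, g.
have S0 : 0 < sup S.
  have /nbhs_ballP[e /= e0 he] := open_nbhs_nbhs (conj oO Ox0).
  pose x1 : 'rV[R]_n := x0 + (e / 2) *: delta_mx ord0 (Ordinal n_gt0).
  have x1x0 : `|x1 - x0| = e / 2.
    rewrite /x1 addrAC subrr add0r normrZ gtr0_norm ?divr_gt0//.
    suff -> : `|delta_mx ord0 (Ordinal n_gt0) : 'rV[R]_n| = 1 by rewrite mulr1.
    apply/eqP; rewrite eq_le; apply/andP; split.
      apply: norm_le_coord => // i; rewrite mxE.
      by case: (_ && _); rewrite ?normr1 ?normr0.
    apply: le_trans (coord_le_norm _ (Ordinal n_gt0)).
    by rewrite mxE !eqxx normr1.
  have Ox1 : Omega x1.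
    by apply: he; rewrite -ball_normE/= distrC x1x0 ltr_pdivrMr// ltr_pMr// ltr1n.
  have [l [g h]] := Oc _ Ox1.
  have Sl : S l by exists x1, g.
  apply: lt_le_trans (ub_le_sup supS.2 Sl).
  have [gl _ [g0x glx0] _ _] := h.
  have [l0 _ _] := gl.
  have := S_lip l g 0 l gl (lexx 0) l0 (lexx l).
  by rewrite g0x glx0 distrC x1x0 subr0; apply: lt_le_trans; rewrite divr_gt0.
have [l1 [x1 [g1 [gl1 _ [_ g1x0] l1b l1d]]] sl1] : exists2 l1, S l1 & sup S < 2 * l1.
  have S20 : 0 < sup S / 2 by rewrite divr_gt0.
  have [l1 Sl1 h] := sup_adherent S20 supS.
  by exists l1 => //; lra.
have l10 : 0 < l1 by have := lt_trans S0 sl1; rewrite pmulr_rgt0.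
have aE s : alpha / beta * s = s / kappa by rewrite /kappa invf_div mulrC.
have nk0 : 0 < 8 * n%:R * kappa by rewrite mulr_gt0// mulr_gt0.
have /dyadic_scale[m0 /andP[m0lo m0hi]] : 0 < l1 / (8 * n%:R * kappa).
  by rewrite divr_gt0.
rewrite ler_pdivrMr// in m0lo.
have m0hi' : 4 * n%:R * kappa * dyadic m0 <= l1.
  rewrite mulrA ler_pdivlMr// in m0hi.
  rewrite -(ler_pM2l (_ : 0 < 2 :> R))//; apply: le_trans m0hi.
  by rewrite le_eqVlt; apply/orP; left; apply/eqP; ring.
exists x0, m0; split => //; first exact: le_trans l1b.
  have := l1d l1; rewrite lexx (ltW l10) g1x0 => /(_ isT).
  rewrite aE => /(ball2_sub_domain oO Ox0) h z zr; apply: h.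
  rewrite /ball2/=; apply: lt_le_trans zr _; rewrite ler_pdivlMr//.
  by apply: le_trans m0hi'; rewrite mulrAC.
move=> x Ox; have [l [g h]] := Oc _ Ox.
have [gl gO [g0x glx0] lb gd] := h; have [l0 _ _] := gl.
exists l, g; split=> //.
- by move=> s t; exact: S_lip.
- move=> s sl; rewrite -aE; apply: ball2_sub_domain (gd s sl) => //.
  exact: gO.
have : l <= sup S by apply: (ub_le_sup supS.2); exists x, g.
move=> ls; apply: (@le_trans _ _ (2 * l1)).
  by apply: ltW; exact: le_lt_trans ls sl1.
rewrite (_ : 16 * _ * _ * _ = 2 * (dyadic m0 * (8 * n%:R * kappa))); last by ring.
by rewrite ler_pM2l.
Qed.

(** The averages over the cube at x0 are bounded, so they have a cluster point.
    It serves for all x and all levels t at once, because each estimate along a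
    chain holds for all large N. *)
Lemma grid_mean_cluster (Omega : set 'rV[R]_n) u (x0 : 'rV[R]_n) (m0 : int) :
  C1 Omega u -> (forall z, `|z - x0| <= 2 * dyadic m0 -> Omega z) ->
  exists b : R, forall (A : nat -> Prop) e, 0 < e -> (\forall N \near \oo, A N) ->
    exists2 N, A N & `|b - grid_mean u N m0 (cube_index m0 x0)| < e.
Proof.
move=> C1u boxO; pose v N := grid_mean u N m0 (cube_index m0 x0).
have d20 : 0 <= 2 * dyadic m0 :> R by rewrite mulr_ge0// dyadic_ge0.
have [B hB] : exists B, forall z, `|z - x0| <= 2 * dyadic m0 -> `|u z| <= B.
  have cu : {within [set z | `|z - x0| <= 2 * dyadic m0], continuous u}.
    apply: continuous_in_subspaceT => z /set_mem/= zx.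
    exact: differentiable_continuous (C1u z (boxO z zx)).1.
  have /compact_bounded[B [_ hB]] := continuous_compact cu (compact_box (y := x0) d20).
  exists (B + 1) => z zx; apply: (hB (B + 1)); first by rewrite ltrDl.
  by exists z.
have vB : \forall N \near \oo, v N \in `[- B, B].
  near=> N.
  have mN : (absz m0 <= N)%N by near: N; exact: nbhs_infty_ge.
  pose r' := absz (N%:Z + m0); have rE : m0 = r'%:Z - N%:Z := grid_scale mN.
  rewrite in_itv/= -ler_norml /v /grid_mean -/r'.
  have W0 : 0 < ((2 ^ r') ^ n)%:R :> R by rewrite ltr0n !expn_gt0.
  rewrite normrM [X in _ * X]gtr0_norm ?invr_gt0// ler_pdivrMr//.
  apply: le_trans (ler_norm_sum _ _ _) _.
  rewrite (_ : B * _ = \sum_(w : {ffun 'I_n -> 'I_(2 ^ r')}) B); last first.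
    by rewrite sumr_const card_ffun !card_ord -[RHS]mulr_natr.
  apply: ler_sum => w _; apply: hB.
  apply: (adjacent_cube_dist (k := cube_index m0 x0)).
    by move=> i; rewrite subrr normr0.
  by rewrite {1}rE; exact: block_point_cube.
have [b [_ bv]] := @segment_compact R (- B) B (v @ \oo) _ vB.
exists b => A e e0 nA.
have nAv : (v @ \oo) (v @` [set N | A N]).
  by apply: filterS nA => N AN; exists N.
have [_ [[N AN <-] Ne]] := bv _ _ nAv (nbhsx_ballx b e e0).
by exists N => //; move: Ne; rewrite -ball_normE.
Unshelve. all: by end_near. Qed.

Lemma john_oscillation (delta alpha beta : R) (Omega : set 'rV[R]_n) u :
  0 < delta <= n%:R -> john_domain alpha beta Omega -> C1 Omega u ->
  exists b : R, forall (t : R) J lev P, 0 < t ->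
  (forall i z, Omega z -> 2 ^+ i * t < norm2 (gradient u z) ->
    exists b, \forall z' \near z,
      exists2 a, (a < b)%N & [/\ J a, lev a = i & cube (P a) z']) ->
  forall x, Omega x -> 144 * n%:R * beta * t < `|u x - b| ->
  exists2 Q, heavy delta J P (level_weight delta lev P) Q &
    `|x - corner Q| <= 35 * n%:R * (beta / alpha) * side Q.
Proof.
move=> /andP[d0 dn] jO C1u.
have [[oO _] _ /andP[a0 ab] _] := jO.
have b0 : 0 < beta by apply: lt_le_trans ab.
have k1 : 1 <= beta / alpha by rewrite ler_pdivlMr// mul1r.
have [x0 [m0 [Ox0 m0b x0ball curves]]] := john_base jO.
have n0 : 0 < n%:R :> R by rewrite ltr0n.
have boxO z : `|z - x0| <= 2 * dyadic m0 -> Omega z.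
  move=> zx; apply: x0ball; rewrite /ball2/=.
  apply: le_lt_trans (norm2_le _) _.
  apply: (@le_lt_trans _ _ (n%:R * (2 * dyadic m0))); first by rewrite ler_wpM2l.
  rewrite (_ : 4 * n%:R * dyadic m0 = 2 * (n%:R * (2 * dyadic m0))); last by ring.
  by rewrite ltr_pMl ?ltr1n// !mulr_gt0// dyadic_gt0.
have [b hb] := grid_mean_cluster C1u boxO.
exists b => t J lev P t0 cov x Ox big; apply: contrapT => noQ.
have [l [g [l0 glip [g0x glx0] gball lle]]] := curves x Ox.
have noH Q : heavy delta J P (level_weight delta lev P) Q ->
    ~ (`|x - corner Q| <= 35 * n%:R * (beta / alpha) * side Q).
  by move=> hQ xQ; apply: noQ; exists Q.
(* Half of the excess: the chain and the choice of b each lose at most e. *)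
pose e := (`|u x - b| - 144 * n%:R * beta * t) / 2.
have e0 : 0 < e by rewrite divr_gt0// subr_gt0.
have est := chain_estimate n_gt0 d0 dn oO C1u t0 cov k1 l0 glip g0x glx0 gball
  x0ball lle Ox noH e0.
have [N hN bN] := hb _ _ e0 est.
have C : 576 * n%:R ^+ 2 * (beta / alpha) * t * dyadic m0 <= 144 * n%:R * beta * t.
  rewrite (_ : 576 * _ * _ * _ * _ = 144 * n%:R * t *
    (4 * n%:R * (beta / alpha) * dyadic m0)); last by ring.
  rewrite (_ : 144 * n%:R * beta * t = 144 * n%:R * t * beta); last by ring.
  by rewrite ler_pM2l// !mulr_gt0.
set v := grid_mean u N m0 _ in hN bN *.
have tri : `|u x - b| <= `|v - u x| + `|b - v|.
  by rewrite (distrC v) (distrC b); exact: ler_distD.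
have {}tri : `|u x - b| <= 144 * n%:R * beta * t + e + `|b - v|.
  by apply: le_trans tri _; rewrite lerD2r; apply: le_trans hN _; rewrite lerD2r.
have ube : `|u x - b| = 144 * n%:R * beta * t + 2 * e by rewrite /e; field.
move: tri bN ube; lra.
Qed.

End john_oscillation.

(** * The weak-type estimate and the theorem *)

Section weak_type.
Context {R : realType} {n : nat} (delta : R).
Hypothesis n_gt0 : (0 < n)%N.
Hypothesis delta_gt0 : 0 < delta.
Hypothesis delta_le : delta <= n%:R.

(** Heaviness adds up weights over a single index set, so the dyadic covers of
    all levels have to be enumerated together. *)
Lemma level_cover (E : nat -> set 'rV[R]_n) (s : nat -> R) :
  (forall i, hausdorff_content delta (E i) < (s i)%:E)%E ->
  exists (J : set nat) (lev : nat -> nat) (P : nat -> int * 'rV[int]_n),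
    (forall i z, E i z -> exists b, \forall z' \near z,
       exists2 a, (a < b)%N & [/\ J a, lev a = i & cube (P a) z']) /\
    (\esum_(a in J) (level_weight delta lev P a)%:E <=
     \sum_(i <oo) ((2 ^+ i) `^ (delta / n%:R)
                   * ((3 ^ n)%:R * 2 `^ delta * s i))%:E)%E.
Proof.
move=> Es; pose I := (nat * {ffun 'I_n -> 'I_3})%type.
have /choice[JP hJP] i : exists JP : set I * (I -> int * 'rV[int]_n),
    (\esum_(a in JP.1) ((side (JP.2 a) : R) `^ delta)%:E
       <= ((3 ^ n)%:R * 2 `^ delta * s i)%:E)%E /\
    forall z, E i z -> exists l : seq I,
      \forall z' \near z, exists2 a, a \in l & JP.1 a /\ cube (JP.2 a) z'.
  have [J [P ?]] := dyadic_cover (ltW delta_gt0) (Es i).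
  by exists (J, P).
pose JJ : set (nat * I) := setT `*`` (fun i => (JP i).1).
pose lev a := oapp (@fst nat I) 0%N (unpickle a).
pose P a := oapp (fun ia : nat * I => (JP ia.1).2 ia.2) (0, 0) (unpickle a).
exists (pickle @` JJ), lev, P; split.
  move=> i z Ez; have [l hl] := (hJP i).2 z Ez.
  exists (\max_(a <- l) pickle (i, a)).+1.
  near=> z'.
  have [a al [Ja Pa]] : exists2 a, a \in l & (JP i).1 a /\ cube ((JP i).2 a) z'.
    by near: z'.
  exists (pickle (i, a)).
    rewrite ltnS.
    exact: (@leq_bigmax_seq _ l xpredT (fun a => pickle (i, a)) a al isT).
  by split; rewrite /lev /P ?pickleK//; exists (i, a).
rewrite esum_image; last by move=> ? ? _ _; exact: (pcan_inj pickleK).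
have -> : (\esum_(k in JJ) (level_weight delta lev P (pickle k))%:E =
    \esum_(i in setT) \esum_(a in (JP i).1)
      ((2 ^+ i) `^ (delta / n%:R) * (side ((JP i).2 a) : R) `^ delta)%:E)%E.
  rewrite esum_esum; last by move=> i a _ _; rewrite lee_fin mulr_ge0// powR_ge0.
  by apply: eq_esum => -[i a] _; rewrite /level_weight /lev /P pickleK.
rewrite nneseries_esumT; last first.
  move=> i; rewrite EFinM mule_ge0 ?lee_fin ?powR_ge0// -lee_fin.
  apply: le_trans (hJP i).1; apply: esum_ge0 => a _.
  by rewrite lee_fin powR_ge0.
apply: le_esum => i _; apply: le_trans (esumZ_le _ _ _) _; rewrite ?powR_ge0//.
  by move=> a; exact: powR_ge0.
by rewrite [leRHS]EFinM lee_wpmul2l ?lee_fin ?powR_ge0//; exact: (hJP i).1.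
Unshelve. all: by end_near. Qed.

(** The distributional inequality behind the theorem. The covers of the level
    sets are chosen optimal up to errors whose weighted sum is e, and e is
    arbitrary. *)
Lemma weak_type (Omega : set 'rV[R]_n) u (alpha beta : R) :
  john_domain alpha beta Omega -> C1 Omega u ->
  exists b : R, forall t, 0 < t ->
  (hausdorff_content delta
     [set x | Omega x /\ (144 * n%:R * beta * t < `|u x - b|)%R] <=
   \sum_(i <oo) ((70 * n%:R ^+ 2 * (beta / alpha)) `^ delta
        * ((3 ^ n)%:R * 2 `^ delta) * (2 ^+ i) `^ (delta / n%:R))%:E
      * hausdorff_content delta
          [set x | Omega x /\ (2 ^+ i * t < norm2 (gradient u x))%R])%E.
Proof.
move=> jO C1u.
have dd : 0 < delta <= n%:R by rewrite delta_gt0.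
have [b hb] := john_oscillation n_gt0 dd jO C1u.
have [_ _ /andP[a0 ab] _] := jO.
have n1 : 1 <= n%:R :> R by rewrite ler1n.
have k1 : 1 <= beta / alpha by rewrite ler_pdivlMr// mul1r.
exists b => t t0.
set kappa := beta / alpha in k1 *.
set C0 := _ `^ delta; set C1 := _ * 2 `^ delta.
pose E i := [set x | Omega x /\ 2 ^+ i * t < norm2 (gradient u x)].
pose a i : R := C0 * C1 * (2 ^+ i) `^ (delta / n%:R).
set S := (\sum_(i <oo) _)%E.
have C00 : 0 < C0.
  have k0 : 0 < kappa := lt_le_trans ltr01 k1.
  by apply/powR_gt0/mulr_gt0 => //; rewrite mulr_gt0// exprn_gt0// ltr0n.
have C10 : 0 < C1 by rewrite mulr_gt0 ?powR_gt0// ltr0n expn_gt0.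
have a_gt0 i : 0 < a i by rewrite !mulr_gt0// powR_gt0// exprn_gt0.
have SE : S = (\sum_(i <oo) (a i)%:E * hausdorff_content delta (E i))%E by [].
have [->|Sfin] := eqVneq S +oo%E; first exact: leey.
have term0 i : (0 <= (a i)%:E * hausdorff_content delta (E i))%E.
  by rewrite mule_ge0 ?hausdorff_content_ge0// lee_fin ltW.
have Efin i : hausdorff_content delta (E i) \is a fin_num.
  rewrite ge0_fin_numE ?hausdorff_content_ge0// ltey.
  apply: contra_neq Sfin => Ey; apply/eqP; rewrite -leye_eq SE.
  apply: (@le_trans _ _ (\sum_(0 <= j < i.+1)
    (a j)%:E * hausdorff_content delta (E j))%E).
    rewrite big_nat_recr//= Ey gt0_muley ?lte_fin// addey//.
    by rewrite gt_eqF// (lt_le_trans (ltNyr 0))// sume_ge0.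
  by apply: nneseries_lim_ge.
apply/lee_addgt0Pr => e e0.
pose s i := fine (hausdorff_content delta (E i)) + e / (2 ^ i.+1)%:R / a i.
have Es i : (hausdorff_content delta (E i) < (s i)%:E)%E.
  rewrite -[ltLHS]fineK// lte_fin ltrDl !divr_gt0// ltr0n expn_gt0.
have [J [lev [P [cov W]]]] := level_cover Es.
apply: (@le_trans _ _ (C0%:E * \esum_(a in J) (level_weight delta lev P a)%:E)%E).
  have L1 : 1 < 35 * n%:R * kappa.
    by have : 1 <= n%:R * kappa by [rewrite mulr_ege1]; lra.
  have := hausdorff_content_heavy delta_gt0 J P
    (level_weight_ge0 delta lev P) n_gt0 L1.
  rewrite (_ : 2 * n%:R * (35 * n%:R * kappa) = 70 * n%:R ^+ 2 * kappa); last by ring.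
  apply: le_trans; apply: le_hausdorff_content => x [Ox big].
  by apply: (hb t J lev P t0 _ x Ox big) => i z Oz fz; apply: cov; split.
apply: le_trans (lee_wpmul2l _ W) _; first by rewrite lee_fin ltW.
rewrite -nneseriesZl; last first.
  move=> i _; rewrite lee_fin mulr_ge0 ?powR_ge0// mulr_ge0 ?(ltW C10)//.
  by rewrite -lee_fin ltW// (le_lt_trans _ (Es i))// hausdorff_content_ge0.
rewrite SE; apply: le_trans (epsilon_trick xpredT term0 (ltW e0)).
rewrite le_eqVlt; apply/orP; left; apply/eqP; apply: eq_eseriesr => i _.
rewrite -(fineK (Efin i)) -!EFinM -EFinD; congr EFin; rewrite /s /a.
set h := fine _; set w := _ `^ (delta / _).
have w0 : w != 0 by rewrite gt_eqF// powR_gt0// exprn_gt0.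
by rewrite -/C1; field; rewrite w0 pnatr_eq0 expn_eq0/= !gt_eqF.
Qed.

End weak_type.

Lemma sum_geometric_le (R : realType) (K rho : R) : 0 <= K -> 0 < rho < 1 ->
  (\sum_(i <oo) (K * rho ^+ i)%:E <= (K / (1 - rho))%:E)%E.
Proof.
move=> K0 /andP[r0 r1]; have r10 : 0 < 1 - rho by rewrite subr_gt0.
have t0 i : (0 <= (K * rho ^+ i)%:E)%E by rewrite lee_fin mulr_ge0// exprn_ge0// ltW.
apply: lime_le; first exact: is_cvg_nneseries.
apply: nearW => N; rewrite sumEFin lee_fin -mulr_sumr ler_wpM2l//.
rewrite -[leRHS]mul1r ler_pdivlMr//.
suff -> : (\sum_(0 <= i < N) rho ^+ i) * (1 - rho) = 1 - rho ^+ N.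
  by rewrite gerBl exprn_ge0// ltW.
elim: N => [|N IH]; first by rewrite big_geq// mul0r expr0 subrr.
by rewrite big_nat_recr//= mulrDl IH exprS; ring.
Qed.

Theorem theorem3p2 (R : realType) (n : nat) (delta p : R) :
  (2 <= n)%N -> 0 < delta <= n%:R -> delta / n%:R < p ->
  exists2 c : R, 0 < c &
    forall (Omega : set 'rV[R]_n) (alpha beta : R),
      john_domain alpha beta Omega ->
      forall u : 'rV[R]_n -> R, C1 Omega u ->
      (ereal_inf [set choquet_integral delta Omega
                        (fun x => (`|u x - b| `^ p)%:E) | b in [set: R]]
       <= (c * beta `^ p * (beta / alpha) `^ (2 * n%:R * p))%:E
          * choquet_integral delta Omega
              (fun x => (norm2 (gradient u x) `^ p)%:E))%E.
Proof.
move=> n2 /andP[d0 dn] qp.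
have n_gt0 : (0 < n)%N by apply: leq_trans n2.
have n0 : 0 < n%:R :> R by rewrite ltr0n.
set q := delta / n%:R in qp.
have q0 : 0 < q by rewrite divr_gt0.
have p0 : 0 < p by apply: lt_trans qp.
pose rho : R := 2 `^ (q - p).
have rho01 : 0 < rho < 1.
  rewrite powR_gt0//= -(powRr0 2) /rho /powR pnatr_eq0/= ltr_expR mul0r.
  by rewrite pmulr_llt0 ?ln_gt0 ?ltr1n// subr_lt0.
(* c0 is the constant of the weak-type inequality without its power of
   beta / alpha, and 1 / (1 - rho) is the sum of the geometric series. *)
pose c0 := (70 * n%:R ^+ 2) `^ delta * ((3 ^ n)%:R * 2 `^ delta) : R.
have c00 : 0 < c0.
  by rewrite !mulr_gt0 ?powR_gt0 ?mulr_gt0 ?exprn_gt0// ltr0n expn_gt0.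
pose c := c0 * (144 * n%:R) `^ p / (1 - rho).
have c_gt0 : 0 < c.
  by rewrite !mulr_gt0 ?powR_gt0 ?mulr_gt0// invr_gt0 subr_gt0; case/andP: rho01.
exists c => // Omega alpha beta jO u C1u.
have [_ _ /andP[a0 ab] _] := jO.
have b0 : 0 < beta by apply: lt_le_trans ab.
have k1 : 1 <= beta / alpha by rewrite ler_pdivlMr// mul1r.
set kappa := beta / alpha in k1 *.
have k0 : 0 < kappa by apply: lt_le_trans k1.
have [b wt] := weak_type n_gt0 d0 dn jO C1u.
apply: ge_ereal_inf; eexists; first by exists b.
rewrite /choquet_integral.
set G := fun t : R => hausdorff_content delta
  [set x | Omega x /\ (t%:E < (`|u x - b| `^ p)%:E)%E].
set F := fun t : R => hausdorff_content delta
  [set x | Omega x /\ (t%:E < (norm2 (gradient u x) `^ p)%:E)%E].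
pose L := 144 * n%:R * beta.
(* The level tau of |u - b|^p corresponds to t = tau^(1/p) / L, and the i-th
   level of the gradient to tau mu_i. *)
have L0 : 0 < L by rewrite !mulr_gt0.
pose a i : R := c0 * kappa `^ delta * (2 ^+ i) `^ q.
pose mu i : R := (2 ^+ i / L) `^ p.
have a_gt0 i : 0 < a i.
  by apply: mulr_gt0; [apply: mulr_gt0 => //|]; apply: powR_gt0 => //; exact: exprn_gt0.
have mu_gt0 i : 0 < mu i by apply/powR_gt0/divr_gt0 => //; exact: exprn_gt0.
have F0 t : (0 <= F t)%E by exact: hausdorff_content_ge0.
have G0 t : (0 <= G t)%E by exact: hausdorff_content_ge0.
have niF s t : s <= t -> (F t <= F s)%E.
  move=> st; apply: le_hausdorff_content => x [Ox h]; split=> //.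
  by apply: le_lt_trans h; rewrite lee_fin.
have niG s t : s <= t -> (G t <= G s)%E.
  move=> st; apply: le_hausdorff_content => x [Ox h]; split=> //.
  by apply: le_lt_trans h; rewrite lee_fin.
have GF t : 0 < t -> (G t <= \sum_(i <oo) (a i)%:E * F (t * mu i)%R)%E.
  move=> t0; pose s := t `^ p^-1 / L.
  have s0 : 0 < s by rewrite divr_gt0// powR_gt0.
  apply: (@le_trans _ _ (hausdorff_content delta
      [set x | Omega x /\ (L * s < `|u x - b|)%R])).
    apply: le_hausdorff_content => x [Ox]; rewrite lte_fin => h; split=> //.
    rewrite /s mulrC divfK ?gt_eqF//.
    have := @gt0_ltr_powR R p^-1 _ _ _ _ _ h.
    rewrite -powRrM divff ?gt_eqF// powRr1//; apply.
    - by rewrite invr_gt0.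
    - by rewrite nnegrE ltW.
    - by rewrite nnegrE powR_ge0.
  apply: le_trans (wt s s0) _; apply: lee_nneseries => i _.
    by move=> _; rewrite mule_ge0 ?hausdorff_content_ge0// lee_fin !mulr_ge0 ?powR_ge0.
  have -> : (70 * n%:R ^+ 2 * kappa) `^ delta * ((3 ^ n)%:R * 2 `^ delta) *
     (2 ^+ i) `^ (delta / n%:R) = a i.
    have nn : 0 <= 70 * n%:R ^+ 2 :> R by rewrite mulr_ge0// exprn_ge0.
    by rewrite (powRM _ nn (ltW k0)) /a /c0 -/q; ring.
  rewrite lee_wpmul2l//; first by rewrite lee_fin ltW.
  apply: le_hausdorff_content => x [Ox h]; split=> //; rewrite lte_fin.
  have -> : t * mu i = (2 ^+ i * s) `^ p.
    rewrite /s mulrCA powRM ?powR_ge0 ?divr_ge0 ?exprn_ge0 ?(ltW L0)//.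
    by rewrite -powRrM mulVf ?gt_eqF// powRr1 ?(ltW t0).
  apply: gt0_ltr_powR => //; rewrite nnegrE ?norm2_ge0//.
  by rewrite mulr_ge0 ?exprn_ge0// ltW.
apply: le_trans (integral_le_dilation_series F0 G0 niF niG a_gt0 mu_gt0 GF) _.
apply: lee_wpmul2r; first exact: integral_ge0.
have amu i : a i / mu i = c0 * kappa `^ delta * L `^ p * rho ^+ i.
  have LV : L^-1 `^ p = (L `^ p)^-1.
    by rewrite -powR_inv1 ?(ltW L0)// -powRrM mulN1r powRN.
  have pow2 r : (2 ^+ i) `^ r = (2 `^ r) ^+ i :> R.
    by rewrite -!powR_mulrn ?powR_ge0// -!powRrM mulrC.
  have rhoE : rho = 2 `^ q / 2 `^ p.
    by rewrite /rho powRB// pnatr_eq0 implybT.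
  rewrite /mu powRM ?exprn_ge0 ?invr_ge0 ?(ltW L0)// LV /a !pow2 rhoE expr_div_n.
  by field; rewrite expf_neq0 ?gt_eqF ?powR_gt0.
have -> : (\sum_(i <oo) (a i / mu i)%:E =
  \sum_(i <oo) (c0 * kappa `^ delta * L `^ p * rho ^+ i)%:E)%E.
  by apply: eq_eseriesr => i _; rewrite amu.
apply: le_trans (sum_geometric_le _ rho01) _.
  by rewrite !mulr_ge0 ?powR_ge0 ?(ltW c00).
rewrite lee_fin.
have kk : kappa `^ delta <= kappa `^ (2 * n%:R * p).
  apply: ler_powR => //; move: qp; rewrite /q ltr_pdivrMr// => /ltW h.
  apply: le_trans h _; rewrite (_ : 2 * n%:R * p = 2 * (p * n%:R)); last by ring.
  by rewrite ler_peMl ?ler1n// mulr_ge0// ltW.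
rewrite (_ : c0 * kappa `^ delta * L `^ p / (1 - rho) = c * beta `^ p * kappa `^ delta).
  by rewrite ler_wpM2l// mulr_ge0 ?powR_ge0// ltW.
rewrite /c /L powRM ?mulr_ge0 ?(ltW n0) ?(ltW b0)//; ring.
Qed.
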